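(* Let $p>3$ be a prime and $E$ a supersingular elliptic curve over $\mathbb{F}_{p^2}$. Suppose $\operatorname{End}(E)$ corresponds to a ternary quadratic form $F$ of discriminant $p$ under the Brandt--Sohn correspondence (i.e. $\operatorname{End}(E)\cong \operatorname{Clf}^0(F)$). Then $j(E)\in\mathbb{F}_p$ (equivalently $E$ is defined over $\mathbb{F}_p$ up to isomorphism) if and only if $F$ properly represents $2$, i.e. $F(v)=2$ for some $v\in\mathbb{Z}^3$ with coprime entries.
   Context: $B_{p,\infty}$ is the quaternion algebra over $\mathbb{Q}$ ramified exactly at $p$ and $\infty$; $\operatorname{End}(E)$ is a maximal order in it. Write a ternary form as $F(x,y,z)=2ax^2+2by^2+2cz^2+2uyz+2vxz+2wxy$ with $a,b,c,u,v,w\in\mathbb{Z}$; its discriminant is $4abc+uvw-au^2-bv^2-cw^2$ ($=\det$ of its symmetric matrix divided by $2$). Its even Clifford order $\operatorname{Clf}^0(F)$ is $\mathbb{Z}+\mathbb{Z}i+\mathbb{Z}j+\mathbb{Z}k$ with $i^2=ui-bc$, $j^2=vj-ac$, $k^2=wk-ab$, $jk=a\bar i=a(u-i)$, $ki=b\bar j=b(v-j)$, $ij=c\bar k=c(w-k)$ (and the remaining products determined by the standard involution). For discriminant $p$ this is a maximal order of $B_{p,\infty}$ (Brandt--Sohn correspondence: a bijection between equivalence classes of such forms and type classes of maximal orders). *)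

(* Defs.v *)
From mathcomp Require Import all_boot all_algebra.
From mathcomp Require mpoly.
Set Implicit Arguments.
Unset Strict Implicit.
Unset Printing Implicit Defensive.
Import GRing.Theory.
Local Open Scope ring_scope.

Section Curve.
Variable L : fieldType.

(* Points of E : y^2 = x^3 + A x + B in the projective plane:
   None is the point at infinity O = (0:1:0), Some (x,y) is (x:y:1). *)
Definition point := option (L * L).

Definition on_curve (A B : L) (P : point) : bool :=
  match P with
  | None => true
  | Some (x, y) => y ^+ 2 == x ^+ 3 + A * x + B
  end.

Definition ec_nonsing (A B : L) : bool := 4%:R * A ^+ 3 + 27%:R * B ^+ 2 != 0.

Definition ec_add (A : L) (P Q : point) : point :=
  match P, Q with
  | None, _ => Q
  | _, None => P
  | Some (x1, y1), Some (x2, y2) =>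
      if (x1 == x2) && (y1 == - y2) then None
      else
        let l := if x1 == x2 then (3%:R * x1 ^+ 2 + A) / (2%:R * y1)
                 else (y2 - y1) / (x2 - x1) in
        let x3 := l ^+ 2 - x1 - x2 in
        Some (x3, l * (x1 - x3) - y1)
  end.

Fixpoint ec_mul (A : L) (n : nat) (P : point) : point :=
  match n with
  | 0 => None
  | n'.+1 => ec_add A P (ec_mul A n' P)
  end.

Definition j_inv (A B : L) : L :=
  1728%:R * (4%:R * A ^+ 3) / (4%:R * A ^+ 3 + 27%:R * B ^+ 2).

Definition supersingular (p : nat) (A B : L) : Prop :=
  forall P, on_curve A B P -> ec_mul A p P = None -> P = None.

Definition coords (P : point) : 'I_3 -> L :=
  match P with
  | None => fun i => nth 0 [:: 0; 1; 0] i
  | Some (x, y) => fun i => nth 0 [:: x; y; 1] i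
  end.

Definition is_homog (d : nat) (g : mpoly.mpoly 3 L) : bool :=
  all (fun m => mpoly.mdeg m == d) (mpoly.msupp g).

Definition peval (g : mpoly.mpoly 3 L) (P : point) : L :=
  mpoly.meval (coords P) g.

(* phi : E -> E is a morphism of projective varieties: locally, around each
   point, it is given by a triple of homogeneous polynomials of the same
   degree that do not all vanish there. *)
Definition is_morphism (A B : L) (phi : point -> point) : Prop :=
  (forall P, on_curve A B P -> on_curve A B (phi P)) /\
  forall P, on_curve A B P ->
    exists (d : nat) (g : 'I_3 -> mpoly.mpoly 3 L),
      (forall i, is_homog d (g i)) /\
      (exists i, peval (g i) P != 0) /\
      (forall Q, on_curve A B Q -> (exists i, peval (g i) Q != 0) ->
         exists2 lam : L, lam != 0 &
           forall i, peval (g i) Q = lam * coords (phi Q) i).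

Definition is_endo (A B : L) (phi : point -> point) : Prop :=
  is_morphism A B phi /\ phi None = None.

End Curve.

(* an element x0 + x1 i + x2 j + x3 k of Clf^0(F) *)
Definition clf := (int * int * int * int)%type.

Definition clf_one : clf := (1, 0, 0, 0).

Definition clf_add (x y : clf) : clf :=
  let: (x0, x1, x2, x3) := x in let: (y0, y1, y2, y3) := y in
  (x0 + y0, x1 + y1, x2 + y2, x3 + y3).

(* Multiplication in Clf^0(F) for F = 2ax^2+2by^2+2cz^2+2uyz+2vxz+2wxy:
   i^2 = ui - bc, j^2 = vj - ac, k^2 = wk - ab,
   jk = a(u - i), ki = b(v - j), ij = c(w - k),
   kj = -vw + ai + wj + vk, ik = -uw + wi + bj + uk, ji = -uv + vi + uj + ck
   (the last three from the standard involution). *)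
Definition clf_mul (a b c u v w : int) (x y : clf) : clf :=
  let: (x0, x1, x2, x3) := x in let: (y0, y1, y2, y3) := y in
  ( x0*y0 - b*c*x1*y1 + c*w*x1*y2 - u*w*x1*y3 - u*v*x2*y1 - a*c*x2*y2
      + a*u*x2*y3 + b*v*x3*y1 - v*w*x3*y2 - a*b*x3*y3,
    x0*y1 + x1*y0 + u*x1*y1 + w*x1*y3 + v*x2*y1 - a*x2*y3 + a*x3*y2,
    x0*y2 + x2*y0 + b*x1*y3 + u*x2*y1 + v*x2*y2 - b*x3*y1 + w*x3*y2,
    x0*y3 + x3*y0 - c*x1*y2 + u*x1*y3 + c*x2*y1 + v*x3*y2 + w*x3*y3 ).

Definition form_disc (a b c u v w : int) : int :=
  4 * a * b * c + u * v * w - a * u ^+ 2 - b * v ^+ 2 - c * w ^+ 2.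

Definition form_val (a b c u v w x y z : int) : int :=
  2 * a * x ^+ 2 + 2 * b * y ^+ 2 + 2 * c * z ^+ 2
  + 2 * u * y * z + 2 * v * x * z + 2 * w * x * y.

Definition properly_represents (a b c u v w n : int) : Prop :=
  exists x y z : int, gcdz (gcdz x y) z = 1 /\ form_val a b c u v w x y z = n.

(* End(E) is isomorphic as a ring to Clf^0(F): psi is a bijection from
   Clf^0(F) onto End(E) (endomorphisms compared as maps on E(L)) turning
   +, * and 1 into pointwise addition, composition and the identity. *)
Definition End_iso_Clf (L : fieldType) (A B : L) (a b c u v w : int)
    (psi : clf -> point L -> point L) : Prop :=
  (forall x, is_endo A B (psi x)) /\
      (forall phi, is_endo A B phi ->
        exists x, forall P, on_curve A B P -> psi x P = phi P) /\
      (forall x y, (forall P, on_curve A B P -> psi x P = psi y P) -> x = y) /\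
      (forall x y P, on_curve A B P ->
        psi (clf_add x y) P = ec_add A (psi x P) (psi y P)) /\
      (forall x y P, on_curve A B P ->
        psi (clf_mul a b c u v w x y) P = psi x (psi y P)) /\
      (forall P, on_curve A B P -> psi clf_one P = P).

(* Main.v *)
(** Multiplication by the square root of -disc in the Clifford algebra turns a
    vector of value 1 under F/2 into an element of Clf^0 with square -p, so F
    represents 2 iff End(E) contains an element with square -p.

    Every endomorphism acts on the x-line as a rational function; its degree d is
    a multiplicative quadratic form on End(E) (the parallelogram law holds because
    the pairs {P, Q} and {P + Q, P - Q} are related by a morphism of the projective
    plane defined over the constants), with d(n) = n^2.  If an endomorphism has
    trivial kernel, its x-coordinate is a polynomial, and a derivative argument
    shows that it is t x^(p^k); the curve then satisfies A = t^2 A^(p^k) and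
    B = t^3 B^(p^k).  An element with square -p has degree p, so k = 1 and j is fixed
    by the Frobenius.  Conversely, if j is fixed, a twisted Frobenius x of degree p is
    an endomorphism, and x^2 and [p] have the same x-coordinate up to an
    automorphism, as E is supersingular; hence p divides the trace of x, and
    positivity of d forces trace 0 and norm p. *)
Require Import Defs.
From mathcomp Require Import all_boot all_order all_algebra.
From mathcomp Require Import mpoly.
From mathcomp Require Import ring zify.
From Stdlib Require Import IndefiniteDescription.
Set Implicit Arguments.
Unset Strict Implicit.
Unset Printing Implicit Defensive.
Import Order.TTheory GRing.Theory Num.Theory.
Local Open Scope ring_scope.

(** * The even Clifford order *)

Section EvenClifford.
Variables a b c u v w : int.

Local Notation mul := (clf_mul a b c u v w).

Definition clf_int (m : int) : clf := (m, 0, 0, 0).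

(** The reduced trace: i, j, k are roots of X^2 - uX + bc, X^2 - vX + ac, X^2 - wX + ab, so their
    traces are u, v, w. *)
Definition clf_tr (x : clf) : int :=
  let: (x0, x1, x2, x3) := x in 2 * x0 + u * x1 + v * x2 + w * x3.

Definition clf_opp (x : clf) : clf :=
  let: (x0, x1, x2, x3) := x in (- x0, - x1, - x2, - x3).

(** The reduced norm, [x] times its conjugate [clf_tr x - x]. *)
Definition clf_nm (x : clf) : int :=
  let: (x0, x1, x2, x3) := x in
  x0 ^+ 2 + x0 * (u * x1 + v * x2 + w * x3)
  + b * c * x1 ^+ 2 + a * c * x2 ^+ 2 + a * b * x3 ^+ 2
  + (u * v - c * w) * x1 * x2 + (u * w - b * v) * x1 * x3
  + (v * w - a * u) * x2 * x3.

Lemma clf_nmM x y : clf_nm (mul x y) = clf_nm x * clf_nm y.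
Proof.
by case: x y => [[[x0 x1] x2] x3] [[[y0 y1] y2] y3] /=; ring.
Qed.

Lemma clf_nm_int m : clf_nm (clf_int m) = m ^+ 2.
Proof. by rewrite /=; ring. Qed.

Lemma clf_addC x y : clf_add x y = clf_add y x.
Proof.
by case: x y => [[[x0 x1] x2] x3] [[[y0 y1] y2] y3] /=; congr (_, _, _, _); ring.
Qed.

Lemma clf_addA x y z : clf_add x (clf_add y z) = clf_add (clf_add x y) z.
Proof.
case: x y z => [[[x0 x1] x2] x3] [[[y0 y1] y2] y3] [[[z0 z1] z2] z3] /=.
by congr (_, _, _, _); ring.
Qed.

Lemma clf_addN x : clf_add (clf_opp x) x = clf_int 0.
Proof. by case: x => [[[x0 x1] x2] x3] /=; congr (_, _, _, _); ring. Qed.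

Lemma clf_add0 x : clf_add (clf_int 0) x = x.
Proof. by case: x => [[[x0 x1] x2] x3] /=; congr (_, _, _, _); ring. Qed.

Lemma clf_oppK : involutive clf_opp.
Proof. by case=> [[[x0 x1] x2] x3] /=; rewrite !opprK. Qed.

Lemma clf_oppD x y : clf_opp (clf_add x y) = clf_add (clf_opp x) (clf_opp y).
Proof.
by case: x y => [[[x0 x1] x2] x3] [[[y0 y1] y2] y3] /=; congr (_, _, _, _); ring.
Qed.

Lemma clf_addI x y : clf_add x (clf_opp y) = clf_int 0 -> x = y.
Proof.
move=> h; rewrite -[x]clf_add0 -[RHS]clf_add0 -{1}(clf_addN y) -h.
by rewrite clf_addC clf_addA.
Qed.

Lemma clf_intD m n : clf_add (clf_int m) (clf_int n) = clf_int (m + n).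
Proof. by []. Qed.

Lemma clf_mulN1 x : mul x (clf_int (-1)) = clf_opp x.
Proof. by case: x => [[[x0 x1] x2] x3] /=; congr (_, _, _, _); ring. Qed.

(** [m + x] times its conjugate; the value is the characteristic polynomial of [x] at [-m]. *)
Lemma clf_mul_nm (m : int) x :
  mul (clf_add (clf_int m) x)
      (clf_add (clf_int (m + clf_tr x)) (clf_opp x)) =
  clf_int (m ^+ 2 + clf_tr x * m + clf_nm x).
Proof. by case: x => [[[x0 x1] x2] x3] /=; congr (_, _, _, _); ring. Qed.

Lemma clf_sqr x :
  mul x x = clf_add (mul (clf_int (clf_tr x)) x) (clf_int (- clf_nm x)).
Proof. by case: x => [[[x0 x1] x2] x3] /=; congr (_, _, _, _); ring. Qed.

Lemma clf_sqrN_of_form_val y1 y2 y3 :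
  form_val a b c u v w y1 y2 y3 = 2 ->
  exists x, mul x x = clf_int (- form_disc a b c u v w).
Proof.
rewrite /form_val /form_disc => h.
(* The last three coordinates are the Gram matrix of F applied to y. The first one makes the trace
   0, and the norm is then [form_disc] times F(y)/2. *)
exists (- ((u * a + v * w) * y1 + (v * b + u * w) * y2 + (w * c + u * v) * y3),
        2 * a * y1 + w * y2 + v * y3, w * y1 + 2 * b * y2 + u * y3,
        v * y1 + u * y2 + 2 * c * y3).
rewrite /clf_int /=; congr (_, _, _, _); last 3 first.
- by ring.
- by ring.
- by ring.
apply: (@mulfI _ (2 : int)) => //.
pose q := 2 * a * y1 ^+ 2 + 2 * b * y2 ^+ 2 + 2 * c * y3 ^+ 2
  + 2 * u * y2 * y3 + 2 * v * y1 * y3 + 2 * w * y1 * y2.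
apply: (@etrans _ _ (- form_disc a b c u v w * q)).
  by rewrite /form_disc /q; ring.
by rewrite /q h /form_disc; ring.
Qed.

(** F/2 has integer coefficients, so the square of a common divisor of the entries divides F/2 =
    1. *)
Lemma form_val_primitive x y z :
  form_val a b c u v w x y z = 2 -> properly_represents a b c u v w 2.
Proof.
move=> h; exists x, y, z; split=> //.
set g := gcdz _ _.
have gx : (g %| x)%Z by apply: dvdz_trans (dvdz_gcdl _ _) (dvdz_gcdl _ _).
have gy : (g %| y)%Z by apply: dvdz_trans (dvdz_gcdl _ _) (dvdz_gcdr _ _).
have gz : (g %| z)%Z by apply: dvdz_gcdr.
have g0 : 0 <= g by [].
case/dvdzP: gx h => x' ->; case/dvdzP: gy => y' ->; case/dvdzP: gz => z' ->.
move: g0; move: g => g g0 h.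
have {}h : g * (g * (a * x' ^+ 2 + b * y' ^+ 2 + c * z' ^+ 2 + u * y' * z'
   + v * x' * z' + w * x' * y')) = 1.
  by apply: (@mulfI _ (2 : int)) => //; rewrite mulr1 -[RHS]h /form_val; ring.
have : (g %| 1)%Z by apply/dvdzP; eexists; rewrite mulrC; apply/esym/h.
by rewrite dvdz1; lia.
Qed.

(* The vector is adj(M) x / (2p) for the Gram matrix M of F: the 2x2 minors of
   adj(M) are divisible by det M = 2p, so p divides the squares of its entries. *)
Lemma form_val_of_clf_nm (p : nat) x : prime p ->
  form_disc a b c u v w = p%:Z -> clf_tr x = 0 -> clf_nm x = p%:Z ->
  properly_represents a b c u v w 2.
Proof.
move=> hp; rewrite /form_disc; case: x => [[[x0 x1] x2] x3] /= hd ht hn.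
(* As the trace is 0, [2 * e1], [2 * e2], [2 * e3] are the entries of adj(M) x; the multiples of
   [x0] absorb the halves. *)
pose e1 := 2 * b * c * x1 + (u * v - c * w) * x2 + (u * w - b * v) * x3 + u * x0.
pose e2 := 2 * a * c * x2 + (u * v - c * w) * x1 + (v * w - a * u) * x3 + v * x0.
pose e3 := 2 * a * b * x3 + (u * w - b * v) * x1 + (v * w - a * u) * x2 + w * x0.
have dvd_sqr e k : e ^+ 2 = p%:Z * k -> exists f, e = f * p%:Z.
  move=> h; apply/dvdzP; have : (p%:Z %| e ^+ 2)%Z by rewrite h dvdz_mulr.
  by rewrite !dvdzE abszX Euclid_dvdX // => /andP[].
pose t := 2 * x0 + u * x1 + v * x2 + w * x3.
have t0 : t = 0 by [].
have s1 : e1 ^+ 2 = p%:Z * (4 * b * c - u ^+ 2 - c * x2 ^+ 2 + u * x2 * x3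
   - b * x3 ^+ 2).
  apply: (@mulfI _ (4 : int)) => //; transitivity ((2 * e1 - u * t) ^+ 2).
    by rewrite t0; ring.
  transitivity ((4 * b * c - u ^+ 2) * (4 * p%:Z - t ^+ 2)
    - p%:Z * (4 * c * x2 ^+ 2 - 4 * u * x2 * x3 + 4 * b * x3 ^+ 2)).
    by rewrite -{2}hd -hn /e1 /t; ring.
  by rewrite t0; ring.
have s2 : e2 ^+ 2 = p%:Z * (4 * a * c - v ^+ 2 - c * x1 ^+ 2 + v * x1 * x3
   - a * x3 ^+ 2).
  apply: (@mulfI _ (4 : int)) => //; transitivity ((2 * e2 - v * t) ^+ 2).
    by rewrite t0; ring.
  transitivity ((4 * a * c - v ^+ 2) * (4 * p%:Z - t ^+ 2)
    - p%:Z * (4 * c * x1 ^+ 2 - 4 * v * x1 * x3 + 4 * a * x3 ^+ 2)).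
    by rewrite -{2}hd -hn /e2 /t; ring.
  by rewrite t0; ring.
have s3 : e3 ^+ 2 = p%:Z * (4 * a * b - w ^+ 2 - b * x1 ^+ 2 + w * x1 * x2
   - a * x2 ^+ 2).
  apply: (@mulfI _ (4 : int)) => //; transitivity ((2 * e3 - w * t) ^+ 2).
    by rewrite t0; ring.
  transitivity ((4 * a * b - w ^+ 2) * (4 * p%:Z - t ^+ 2)
    - p%:Z * (4 * b * x1 ^+ 2 - 4 * w * x1 * x2 + 4 * a * x2 ^+ 2)).
    by rewrite -{2}hd -hn /e3 /t; ring.
  by rewrite t0; ring.
have [f1 ef1] := dvd_sqr _ _ s1.
have [f2 ef2] := dvd_sqr _ _ s2.
have [f3 ef3] := dvd_sqr _ _ s3.
have p0 : (p%:Z : int) != 0 by case: p hp {hd hn dvd_sqr s1 s2 s3 ef1 ef2 ef3}.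
apply: (@form_val_primitive f1 f2 f3); rewrite /form_val.
apply: (@mulfI _ (4 * p%:Z ^+ 2 : int)); first by rewrite mulf_neq0 ?expf_neq0.
transitivity (4 * (2 * a * e1 ^+ 2 + 2 * b * e2 ^+ 2 + 2 * c * e3 ^+ 2
  + 2 * u * e2 * e3 + 2 * v * e1 * e3 + 2 * w * e1 * e2)).
  by rewrite ef1 ef2 ef3; ring.
transitivity (8 * p%:Z * p%:Z - 2 * p%:Z * t ^+ 2 + 4 * p%:Z * t * (t - 2 * x0)
  + t ^+ 2 * (2 * a * u ^+ 2 + 2 * b * v ^+ 2 + 2 * c * w ^+ 2 + 6 * u * v * w)).
  rewrite -{2}hn -!hd /e1 /e2 /e3 /t; ring.
by rewrite t0; ring.
Qed.

(** Subtracting m^2 leaves a function with zero second difference, hence an affine one; negative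
    arguments follow by reflecting [f]. *)
Lemma second_difference (f : int -> int) :
  (forall m, f (m + 1) + f (m - 1) = 2 * f m + 2) ->
  forall m, f m = m ^+ 2 + m * (f 1 - f 0 - 1) + f 0.
Proof.
have nat_case (g : int -> int) : (forall m, g (m + 1) + g (m - 1) = 2 * g m + 2) ->
    forall n : nat, g n%:Z = n%:Z ^+ 2 + n%:Z * (g 1 - g 0 - 1) + g 0
      /\ g n.+1%:Z = n.+1%:Z ^+ 2 + n.+1%:Z * (g 1 - g 0 - 1) + g 0.
  move=> hg; elim=> [|n [IH0 IH1]]; first by split; ring.
  split=> //; have := hg n.+1%:Z.
  have -> : n.+1%:Z + 1 = n.+2%:Z by lia.
  have -> : n.+1%:Z - 1 = n%:Z by lia.
  rewrite IH0 IH1; have -> : n.+2%:Z = n%:Z + 2 by lia.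
  have -> : n.+1%:Z = n%:Z + 1 by lia.
  by move=> h; apply: (@addIr _ (n%:Z ^+ 2 + n%:Z * (g 1 - g 0 - 1) + g 0)); rewrite h; ring.
move=> hf m; have [n [->|->]] : exists n : nat, m = n%:Z \/ m = - n%:Z.
- by exists `|m|%N; lia.
- by case: (nat_case f hf n).
have hg k : f (- (k + 1)) + f (- (k - 1)) = 2 * f (- k) + 2.
  by rewrite -hf addrC; congr (f _ + f _); ring.
have [-> _] := nat_case (fun k => f (- k)) hg n.
have := hf 0; rewrite add0r sub0r oppr0 => h.
have -> : f (- 1) = 2 * f 0 + 2 - f 1 by rewrite -h; ring.
by ring.
Qed.

Section Degree.
Variable d : clf -> nat.
Hypotheses (d0 : d (clf_int 0) = 0%N) (d1 : d (clf_int 1) = 1%N).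
Hypothesis dD : forall y z,
  (d (clf_add y z) + d (clf_add y (clf_opp z)) = 2 * d y + 2 * d z)%N.

(** The parallelogram law for [m + x] and 1 says that [d] has second difference 2 along the
    translates of [x] by integers. *)
Lemma degree_add_int x m :
  (d (clf_add (clf_int m) x))%:Z =
    m ^+ 2 + m * ((d (clf_add (clf_int 1) x))%:Z - (d x)%:Z - 1) + (d x)%:Z.
Proof.
pose f m := (d (clf_add (clf_int m) x))%:Z.
have hf k : f (k + 1) + f (k - 1) = 2 * f k + 2.
  have := dD (clf_add (clf_int k) x) (clf_int 1); rewrite d1.
  have e1 : clf_add (clf_add (clf_int k) x) (clf_int 1) = clf_add (clf_int (k + 1)) x.
    by rewrite -clf_addA [clf_add x _]clf_addC clf_addA.
  have e2 : clf_add (clf_add (clf_int k) x) (clf_opp (clf_int 1))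
      = clf_add (clf_int (k - 1)) x.
    by rewrite -clf_addA [clf_add x _]clf_addC clf_addA /= !oppr0.
  by rewrite e1 e2 /f; lia.
have := second_difference hf m; rewrite /f => ->.
by rewrite clf_add0; ring.
Qed.

Lemma degree_int m : (d (clf_int m))%:Z = m ^+ 2.
Proof.
have := degree_add_int (clf_int 0) m.
by rewrite !clf_intD !addr0 d0 d1 => ->; ring.
Qed.

Hypothesis dN : forall y, d (clf_opp y) = d y.
Hypothesis dM : forall y z, d (mul y z) = (d y * d z)%N.

(* A positive quadratic form on the order that is multiplicative is the norm:
   comparing d(m + x) d(m + t - x) with (m^2 + t m + n)^2 leaves only that or
   t^2 - 4n a square, which is impossible here modulo p^2. *)
Lemma trace_zero_of_degree (p : nat) x :
  prime p -> (3 < p)%N ->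
  clf_nm x ^+ 2 = p%:Z ^+ 2 -> (p%:Z %| clf_tr x)%Z ->
  clf_tr x = 0 /\ clf_nm x = p%:Z.
Proof.
move=> hp hp3 hn ht.
set t := clf_tr x in ht *; set n := clf_nm x in hn *.
have hn' : n = p%:Z \/ n = - p%:Z.
  by move/eqP: hn; rewrite eqf_sqr => /orP[] /eqP; [left | right].
have p5 : (4 < p)%N.
  by rewrite ltn_neqAle hp3 andbT; apply: contraTneq hp => <-.
set B := (d (clf_add (clf_int 1) x))%:Z - (d x)%:Z - 1.
have dx m : (d (clf_add (clf_int m) x))%:Z = m ^+ 2 + m * B + (d x)%:Z.
  exact: degree_add_int.
(* The product of [m + x] and its conjugate is an integer, and [d] of an integer is its square. *)
have key m : (m ^+ 2 + m * B + (d x)%:Z)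
    * ((- (m + t)) ^+ 2 + - (m + t) * B + (d x)%:Z) = (m ^+ 2 + t * m + n) ^+ 2.
  have <- := degree_int (m ^+ 2 + t * m + n).
  rewrite -clf_mul_nm dM PoszM -!dx; congr (_ * (Posz _)).
  by rewrite -[RHS]dN clf_oppD clf_oppK.
set e := (d x)%:Z in dx key.
have [B0 e0] : B = t /\ e = n.
  (* [be] and [de] measure how far the trace and norm read off from [d] are from [t] and [n]; the
     identity at m = 0, 1, -1 suffices to relate them. *)
  pose be := B - t; pose de := e - n.
  have k0 := key 0; have k1 := key 1; have k2 := key (-1).
  have c2 : 2 * de - be * t - be ^+ 2 = 0.
    apply: (@mulfI _ (2 : int)) => //; rewrite mulr0.
    transitivity ((1 ^+ 2 + 1 * B + e) * ((- (1 + t)) ^+ 2 + - (1 + t) * B + e)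
      - (1 ^+ 2 + t * 1 + n) ^+ 2
      + ((-1) ^+ 2 + -1 * B + e) * ((- (-1 + t)) ^+ 2 + - (-1 + t) * B + e)
      - ((-1) ^+ 2 + t * -1 + n) ^+ 2
      - 2 * ((0 ^+ 2 + 0 * B + e) * ((- (0 + t)) ^+ 2 + - (0 + t) * B + e)
      - (0 ^+ 2 + t * 0 + n) ^+ 2)); first by rewrite /be /de; ring.
    by rewrite k0 k1 k2; ring.
  have c0 : n * (2 * de - be * t) + de ^+ 2 - be * t * de = 0.
    transitivity ((0 ^+ 2 + 0 * B + e) * ((- (0 + t)) ^+ 2 + - (0 + t) * B + e)
      - (0 ^+ 2 + t * 0 + n) ^+ 2); first by rewrite /be /de; ring.
    by rewrite k0; ring.
  have e2 : 2 * de = be * (t + be) by apply/eqP; rewrite -subr_eq0 -[X in _ == X]c2; apply/eqP; ring.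
  have : be ^+ 2 * (4 * n + be ^+ 2 - t ^+ 2) = 0.
    transitivity (4 * (n * (2 * de - be * t) + de ^+ 2 - be * t * de)); last by rewrite c0 mulr0.
    transitivity (4 * n * (2 * de - be * t) + (2 * de) ^+ 2 - 2 * be * t * (2 * de)); last by ring.
    by rewrite e2; ring.
  move/eqP; rewrite mulf_eq0 expf_eq0 /= => /orP[/eqP b0|/eqP sq].
    have B0 : B = t by apply/eqP; rewrite -subr_eq0; apply/eqP.
    by move/eqP: e2; rewrite b0 mul0r mulf_eq0 /= subr_eq0 => /eqP.
  (* Here be^2 = t^2 - 4n with n = p or n = -p, and p divides t. So p divides [be], p^2 divides 4n,
     and p divides 4. *)
  exfalso; case/dvdzP: ht => k tk.
  have [l bl] : exists l, be = l * p%:Z.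
    apply/dvdzP; have : (p%:Z %| be ^+ 2)%Z.
      have -> : be ^+ 2 = t ^+ 2 - 4 * n by apply/eqP; rewrite -subr_eq0 -[X in _ == X]sq; apply/eqP; ring.
      case: hn' => ->; apply/dvdzP.
        by exists (k ^+ 2 * p%:Z - 4); rewrite tk; ring.
      by exists (k ^+ 2 * p%:Z + 4); rewrite tk; ring.
    by rewrite !dvdzE abszX Euclid_dvdX // => /andP[].
  have p0 : (p%:Z : int) != 0 by clear -p5; lia.
  have : (p%:Z %| 4)%Z.
    apply/dvdzP; case: hn' sq => ->; rewrite tk bl => sq.
      exists (k ^+ 2 - l ^+ 2); apply: (mulIf p0).
      by apply/eqP; rewrite -subr_eq0 -[X in _ == X]sq; apply/eqP; ring.
    exists (l ^+ 2 - k ^+ 2); apply: (mulIf p0).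
    by apply/eqP; rewrite -subr_eq0 -[X in _ == X]oppr0 -[X in _ == - X]sq; apply/eqP; ring.
  by rewrite dvdzE /= => /dvdn_leq; move: p5; clear; lia.
(* Degrees are nonnegative. With t = kp and n = p, the values at m = 2 and m = -2 give 4 + p >=
   2|k|p, so k = 0 because p > 4. *)
have pos m : 0 <= m ^+ 2 + m * t + n by rewrite -B0 -e0 -dx.
have np : n = p%:Z by case: hn' => // h; move: e0; rewrite h /e; clear -p5; lia.
split=> //; case/dvdzP: ht => k tk.
have := pos 2; have := pos (-2); rewrite np tk.
have [->|] := eqVneq k 0; first by rewrite mul0r.
move: p5; clear; nia.
Qed.
End Degree.
End EvenClifford.

(** * Regular functions on the affine curve *)

Section ClosedField.
Variable L : closedFieldType.

Lemma closed_field_root n (c : L) : (0 < n)%N -> exists y, y ^+ n = c.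
Proof.
move=> n0; have /closed_rootP [y] : size ('X^n - c%:P) != 1%N.
  by rewrite size_XnsubC // eqSS -lt0n.
by rewrite rootE !hornerE subr_eq0 => /eqP; exists y.
Qed.

Lemma poly_eq0P (q : {poly L}) : (forall x, q.[x] = 0) -> q = 0.
Proof.
move=> h; apply/eqP/contraT => /closed_nonrootP [x].
by rewrite rootE h eqxx.
Qed.

Lemma poly_eqP (q r : {poly L}) : (forall x, q.[x] = r.[x]) -> q = r.
Proof.
by move=> h; apply/eqP; rewrite -subr_eq0; apply/eqP/poly_eq0P => x; rewrite !hornerE h subrr.
Qed.

Lemma poly_size1P (q : {poly L}) : (forall x, q.[x] != 0) -> exists2 c, c != 0 & q = c%:P.
Proof.
move=> h; have : size q == 1%N.
  by apply: contraT => /closed_rootP [x]; rewrite rootE (negbTE (h x)).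
by case/size_poly1P => c; exists c.
Qed.

Lemma coprimep_closed (q r : {poly L}) :
  (forall x, q.[x] = 0 -> r.[x] = 0 -> False) -> coprimep q r.
Proof.
move=> h; rewrite /coprimep; apply: contraT => /closed_rootP [x].
by rewrite root_gcd => /andP[/rootP h1 /rootP h2]; case: (h x).
Qed.

Lemma coprimep_evalP (q r : {poly L}) x : coprimep q r -> q.[x] = 0 -> r.[x] = 0 -> False.
Proof.
move=> /coprimep_root h q0; have /h : root q x by apply/rootP.
by move=> /eqP.
Qed.

End ClosedField.

Section Regular.
Variables (L : closedFieldType) (A B : L).

Fact cubic_key : unit. Proof. by []. Qed.

Definition cubic : {poly L} := locked_with cubic_key ('X^3 + A *: 'X + B%:P).

Lemma cubicE x : cubic.[x] = x ^+ 3 + A * x + B.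
Proof. by rewrite [cubic]unlock !hornerE. Qed.

Lemma size_cubic : size cubic = 4%N.
Proof.
rewrite [cubic]unlock -addrA size_polyDl size_polyXn //.
by rewrite (leq_ltn_trans (size_polyD _ _)) // gtn_max
  (leq_ltn_trans (size_scale_leq _ _)) ?size_polyX //= (leq_ltn_trans (size_polyC_leq1 _)).
Qed.

Lemma cubic_neq0 : cubic != 0.
Proof. by rewrite -size_poly_gt0 size_cubic. Qed.

Lemma on_curveE x y : on_curve A B (Some (x, y)) = (y ^+ 2 == cubic.[x]).
Proof. by rewrite cubicE. Qed.

Lemma exists_on_curve x : exists y, on_curve A B (Some (x, y)).
Proof.
have [y hy] := closed_field_root cubic.[x] (isT : (0 < 2)%N).
by exists y; rewrite on_curveE hy.
Qed.

Lemma on_curveN x y : on_curve A B (Some (x, y)) -> on_curve A B (Some (x, - y)).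
Proof. by rewrite /= sqrrN. Qed.

(* A pair (a, b) stands for the element a(x) + b(x) y of the coordinate ring. *)
Definition ev (r : {poly L} * {poly L}) (P : L * L) := r.1.[P.1] + r.2.[P.1] * P.2.

Definition ev_mul (r s : {poly L} * {poly L}) :=
  (r.1 * s.1 + cubic * r.2 * s.2, r.1 * s.2 + r.2 * s.1).

Lemma ev_mulE r s P : on_curve A B (Some P) -> ev (ev_mul r s) P = ev r P * ev s P.
Proof.
case: P => x y; rewrite on_curveE /ev /= => /eqP h.
by rewrite !hornerE -h /=; ring.
Qed.

(** The norm down to polynomials in x: the product with the conjugate under y -> -y. *)
Definition ev_norm (r : {poly L} * {poly L}) := r.1 ^+ 2 - cubic * r.2 ^+ 2.

Lemma ev_normE r x y : on_curve A B (Some (x, y)) ->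
  (ev_norm r).[x] = ev r (x, y) * ev r (x, - y).
Proof.
by rewrite on_curveE /ev /ev_norm /= => /eqP h; rewrite !hornerE -h /=; ring.
Qed.

(** The degree of a^2 is even and that of [cubic] times b^2 is odd, so the two cannot cancel. *)
Lemma ev_norm_eq0 r : ev_norm r = 0 -> r = (0, 0).
Proof.
case: r => a b; rewrite /ev_norm /= => /eqP; rewrite subr_eq0 => /eqP h.
have [b0|b0] := eqVneq b 0.
  by move: h; rewrite b0 expr0n mulr0 => /eqP; rewrite expf_eq0 /= => /eqP ->.
have a0 : a != 0.
  by apply: contra_neq b0 => a0;
    move/esym/eqP: h; rewrite a0 expr0n mulf_eq0 expf_eq0 /= (negbTE cubic_neq0) => /eqP.
have := congr1 (fun q : {poly L} => size q) h.
rewrite expr2 size_mul // size_mul ?cubic_neq0 ?expf_neq0 // expr2 size_mul // size_cubic.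
move: a0 b0; rewrite -!size_poly_gt0; move: (size _) (size _) => m n; lia.
Qed.

Lemma ev_eq0 r (n : {poly L}) : n != 0 ->
  (forall P, on_curve A B (Some P) -> n.[P.1] != 0 -> ev r P = 0) -> r = (0, 0).
Proof.
move=> n0 h; apply: ev_norm_eq0; apply: (mulfI n0); rewrite mulr0.
apply: poly_eq0P => x; have [y hy] := exists_on_curve x.
rewrite hornerM (ev_normE _ hy); have [->|nx] := eqVneq n.[x] 0; first by rewrite mul0r.
by rewrite (h (x, y)) // mul0r mulr0.
Qed.

Definition regular (f : L * L -> L) :=
  exists r, forall P, on_curve A B (Some P) -> f P = ev r P.

Lemma regular_horner (q : {poly L}) : regular (fun P => q.[P.1]).
Proof. by exists (q, 0) => -[x y] _; rewrite /ev /= horner0 mul0r addr0. Qed.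

Lemma regularD f g : regular f -> regular g -> regular (fun P => f P + g P).
Proof.
move=> [r hr] [s hs]; exists (r.1 + s.1, r.2 + s.2) => P hP.
by rewrite (hr P hP) (hs P hP) /ev /= !hornerE /=; ring.
Qed.

Lemma regularM f g : regular f -> regular g -> regular (fun P => f P * g P).
Proof.
move=> [r hr] [s hs]; exists (ev_mul r s) => P hP.
by rewrite (hr P hP) (hs P hP) ev_mulE.
Qed.

Lemma regularC c : regular (fun _ => c).
Proof. by exists (c%:P, 0) => P _; rewrite /ev /= !hornerE. Qed.

Lemma regularN f : regular f -> regular (fun P => - f P).
Proof.
move=> [r hr]; exists (- r.1, - r.2) => P hP.
by rewrite (hr P hP) /ev /= !hornerE /=; ring.
Qed.

Lemma regularX f k : regular f -> regular (fun P => f P ^+ k).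
Proof.
move=> hf; elim: k => [|k [r hr]]; first exact: regularC.
have [s hs] := hf; exists (ev_mul s r) => P hP.
by rewrite exprS (hr P hP) (hs P hP) ev_mulE.
Qed.

Lemma regular_peval (g : mpoly.mpoly 3 L) : regular (fun P => peval g (Some P)).
Proof.
rewrite /peval; elim/mpolyind: g => [|c m g _ _ IH].
  by have [r hr] := regularC 0; exists r => P /hr <-; rewrite meval0.
have regx : regular (fun P => P.1).
  by exists ('X, 0) => P _; rewrite /ev hornerX horner0 mul0r addr0.
have regy : regular (fun P => P.2).
  by exists (0, 1) => P _; rewrite /ev horner0 hornerC mul1r add0r.
have [r hr] := regularD (regularM (regularC c) (regularM (regularX (m ord0) regx)
  (regularX (m (lift ord0 ord0)) regy))) IH.
exists r => -[x y] hP; rewrite -hr // mevalD mevalZ mevalX.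
by rewrite !big_ord_recl big_ord0 /= expr1n !mulr1.
Qed.

Lemma regular_eq0 f (n : {poly L}) : regular f -> n != 0 ->
  (forall P, on_curve A B (Some P) -> n.[P.1] != 0 -> f P = 0) ->
  forall P, on_curve A B (Some P) -> f P = 0.
Proof.
move=> [r hr] n0 h; have r0 : r = (0, 0).
  by apply: (ev_eq0 n0) => P hP nP; rewrite -hr // h.
by move=> P hP; rewrite hr // r0 /ev /= !horner0 mul0r addr0.
Qed.

(** The witness is the norm: it vanishes at the abscissa of every zero of [f]. *)
Lemma regular_cofinite f P0 : regular f -> on_curve A B (Some P0) -> f P0 != 0 ->
  exists2 n : {poly L}, n != 0 &
    forall P, on_curve A B (Some P) -> n.[P.1] != 0 -> f P != 0.
Proof.
move=> [r hr] h0 f0; exists (ev_norm r).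
  apply: contra_neq f0 => /ev_norm_eq0 r0.
  by rewrite hr // r0 /ev /= !horner0 mul0r addr0.
case=> x y hP /=; rewrite (ev_normE _ hP) mulf_eq0 negb_or => /andP[h _].
by rewrite hr.
Qed.

(** The coordinate ring is a domain: if [f] is nonzero, its norm has finitely many roots, and [g]
    vanishes at all points above the other abscissae, hence everywhere. *)
Lemma regular_integral f g : regular f -> regular g ->
  (forall P, on_curve A B (Some P) -> f P * g P = 0) ->
  (forall P, on_curve A B (Some P) -> f P = 0) \/
  (forall P, on_curve A B (Some P) -> g P = 0).
Proof.
move=> [r hr] hg h; have [r0|r0] := eqVneq (ev_norm r) 0.
  left=> P hP; rewrite hr //.
  by rewrite (ev_norm_eq0 r0) /ev /= !horner0 mul0r addr0.
right; apply: (regular_eq0 hg r0) => -[x y] hP.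
rewrite (ev_normE _ hP) mulf_eq0 negb_or => /andP[h1 _].
by have /eqP := h _ hP; rewrite hr // mulf_eq0 (negbTE h1) => /eqP.
Qed.

End Regular.

(** * The x-coordinate of an endomorphism *)

Definition pt_opp (L : fieldType) (P : point L) : point L :=
  if P is Some (x, y) then Some (x, - y) else None.

(* [f : g] are homogeneous coordinates of x(P) on the projective line. *)
Definition xrep (L : fieldType) (P : point L) (f g : L) :=
  if P is Some (x, _) then g != 0 /\ f = x * g else g = 0 /\ f != 0.

Section XCoordinate.
Variables (L : closedFieldType) (A B : L).
Hypothesis two0 : 2%:R != 0 :> L.
Variable phi : point L -> point L.
Hypothesis endo : is_endo A B phi.
Hypothesis odd_phi : forall P, on_curve A B P -> phi (pt_opp P) = pt_opp (phi P).

Let i0 : 'I_3 := Ordinal (isT : (0 < 3)%N).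
Let i1 : 'I_3 := Ordinal (isT : (1 < 3)%N).
Let i2 : 'I_3 := Ordinal (isT : (2 < 3)%N).

(** In one chart the coordinates are quotients r0/r2 and r1/r2. Multiplying by the conjugate of r2
    makes the denominator a polynomial in x, and oddness of [phi] makes the first coordinate even
    and the second odd in y. *)
Lemma endo_generic : exists2 n : {poly L}, n != 0 &
  (forall P, on_curve A B (Some P) -> n.[P.1] != 0 -> phi (Some P) = None) \/
  (exists a b : {poly L}, forall P, on_curve A B (Some P) -> n.[P.1] != 0 ->
     phi (Some P) = Some (a.[P.1] / n.[P.1], b.[P.1] * P.2 / n.[P.1])).
Proof.
have [[_ charts] _] := endo.
have [y0 hy0] := exists_on_curve A B 0.
have [d [g [_ [[j gj] hg]]]] := charts _ hy0.
have [r2 hr2] := regular_peval A B (g i2).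
have [e|r20] := eqVneq (ev_norm A B r2) 0.
  have [n n0 hn] := regular_cofinite (regular_peval A B (g j)) hy0 gj.
  exists n => //; left=> P hP nP.
  have [|lam lam0 hlam] := hg _ hP; first by exists j; apply: hn.
  have := hlam i2; rewrite hr2 // (ev_norm_eq0 e) /ev /= !horner0 mul0r addr0.
  by case: (phi _) => [[X Y]|//] /=; rewrite mulr1 => lam0'; rewrite -lam0' eqxx in lam0.
have [r0 hr0] := regular_peval A B (g i0).
have [r1 hr1] := regular_peval A B (g i1).
pose bar (r : {poly L} * {poly L}) := (r.1, - r.2).
have barE r x y : ev (bar r) (x, y) = ev r (x, - y).
  by rewrite /ev /= hornerN mulrN mulNr.
exists (ev_norm A B r2) => //; right.
exists (ev_mul A B r0 (bar r2)).1, (ev_mul A B r1 (bar r2)).2 => -[x y] hP.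
rewrite -[(x, y).1]/x -[(x, y).2]/y => nP.
have hQ := on_curveN hP.
have value z : on_curve A B (Some (x, z)) -> ev r2 (x, z) != 0 ->
    exists X Y, [/\ phi (Some (x, z)) = Some (X, Y),
      ev r0 (x, z) = X * ev r2 (x, z) & ev r1 (x, z) = Y * ev r2 (x, z)].
  move=> hz nz; have [|lam lam0 hlam] := hg _ hz; first by exists i2; rewrite hr2.
  have := hlam i0; have := hlam i1; have := hlam i2.
  rewrite hr0 // hr1 // hr2 //; case: (phi _) => [[X Y]|] /=; last first.
    by rewrite mulr0 => e; rewrite e eqxx in nz.
  by rewrite mulr1 => <- -> ->; exists X, Y; split; rewrite // mulrC.
move: (nP); rewrite (ev_normE _ hP) mulf_eq0 negb_or => /andP[nz1 nz2].
have [X [Y [e1 e2 e3]]] := value _ hP nz1.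
have [X' [Y' [e1' e2' e3']]] := value _ hQ nz2.
have [eX eY] : X' = X /\ Y' = - Y.
  by have := odd_phi hP; rewrite /= e1 e1' => -[].
rewrite {}eX {}eY in e2' e3'.
(* Sum and difference of the values at (x, y) and (x, -y) isolate the even and odd parts, up to the
   factor 2. *)
have h0 : 2%:R * (ev_mul A B r0 (bar r2)).1.[x] =
   ev (ev_mul A B r0 (bar r2)) (x, y) + ev (ev_mul A B r0 (bar r2)) (x, - y).
  by rewrite /ev /=; ring.
have h1 : 2%:R * ((ev_mul A B r1 (bar r2)).2.[x] * y) =
   ev (ev_mul A B r1 (bar r2)) (x, y) - ev (ev_mul A B r1 (bar r2)) (x, - y).
  by rewrite /ev /=; ring.
move: h0 h1; rewrite !ev_mulE // !barE opprK e2 e3 e2' e3' => h0 h1.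
rewrite e1; congr (Some (_, _)).
  have -> : (ev_mul A B r0 (bar r2)).1.[x] = X * (ev r2 (x, y) * ev r2 (x, - y)).
    by apply: (mulfI two0); rewrite h0; ring.
  by rewrite mulfK // mulf_neq0.
have -> : (ev_mul A B r1 (bar r2)).2.[x] * y = Y * (ev r2 (x, y) * ev r2 (x, - y)).
  by apply: (mulfI two0); rewrite h1; ring.
by rewrite mulfK // mulf_neq0.
Qed.

(* Regular functions separate the finitely many points left out by the generic
   formula; at a point mapped to O the curve equation of the chart,
   v2 (v1^2 - A v0 v2 - B v2^2) = v0^3, forces the pole. *)
Lemma xrep_extend (f g n : {poly L}) : coprimep f g -> n != 0 ->
  (forall P, on_curve A B (Some P) -> n.[P.1] != 0 ->
     xrep (phi (Some P)) f.[P.1] g.[P.1]) ->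
  forall P, on_curve A B (Some P) -> xrep (phi (Some P)) f.[P.1] g.[P.1].
Proof.
move=> cfg n0 gen P hP.
have [[stable charts] _] := endo.
have [d [G [_ [[j Gj] hG]]]] := charts _ hP.
pose v0 P := peval (G i0) (Some P); pose v1 P := peval (G i1) (Some P).
pose v2 P := peval (G i2) (Some P).
have reg0 : regular A B v0 by apply: regular_peval.
have reg1 : regular A B v1 by apply: regular_peval.
have reg2 : regular A B v2 by apply: regular_peval.
have regf : regular A B (fun Q => f.[Q.1]) by apply: regular_horner.
have regg : regular A B (fun Q => g.[Q.1]) by apply: regular_horner.
have regn : regular A B (fun Q => n.[Q.1]) by apply: regular_horner.
have chart Q : on_curve A B (Some Q) ->
    [/\ v0 Q = 0, v1 Q = 0 & v2 Q = 0] \/ exists2 lam, lam != 0 &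
    [/\ v0 Q = lam * coords (phi (Some Q)) i0, v1 Q = lam * coords (phi (Some Q)) i1
      & v2 Q = lam * coords (phi (Some Q)) i2].
  move=> hQ; have [z|nz] := boolP ((v0 Q == 0) && (v1 Q == 0) && (v2 Q == 0)).
    by left; case/andP: z => /andP[/eqP-> /eqP->] /eqP->.
  right; have [|lam lam0 hlam] := hG _ hQ; last by exists lam => //; rewrite /v0 /v1 /v2 !hlam.
  move: nz; rewrite !negb_and -orbA => /or3P[] h.
  - by exists i0.
  - by exists i1.
  - by exists i2.
have cross Q : on_curve A B (Some Q) -> v0 Q * g.[Q.1] - v2 Q * f.[Q.1] = 0.
  have reg := regularD (regularM reg0 regg) (regularN (regularM reg2 regf)).
  move: Q; apply: (regular_eq0 reg n0) => Q hQ nQ.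
  case: (chart Q hQ) => [[-> _ ->]|[lam _ [-> _ ->]]]; first by rewrite !mul0r subrr.
  have := gen _ hQ nQ; case: (phi _) => [[X Y]|] /= [h1 h2]; last first.
    by rewrite h1 !mulr0 mul0r subrr.
  by rewrite h2; ring.
pose w Q := v1 Q ^+ 2 - A * (v0 Q * v2 Q) - B * v2 Q ^+ 2.
have regw : regular A B w.
  apply: regularD; first apply: regularD; first exact: regularX.
    by apply/regularN/regularM; [apply: regularC | apply: regularM].
  by apply/regularN/regularM; [apply: regularC | apply: regularX].
have curve Q : on_curve A B (Some Q) -> v2 Q * w Q = v0 Q ^+ 3.
  move=> hQ; rewrite /w; case: (chart Q hQ) => [[-> -> ->]|[lam _ [-> -> ->]]].
    by rewrite mul0r expr0n.
  have := stable _ hQ; case: (phi _) => [[X Y]|_] /=; last by ring.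
  by move/eqP => e; rewrite -[RHS]addr0 -[0](subrr (lam ^+ 3 * Y ^+ 2)) {2}e; ring.
have [[z0 z1 z2]|[lam lam0 [e0 e1 e2]]] := chart P hP.
  by exfalso; move: Gj; case: j => -[|[|[|//]]] hj; apply/negP; rewrite negbK; apply/eqP;
    [rewrite -[RHS]z0 | rewrite -[RHS]z1 | rewrite -[RHS]z2]; congr (peval (G _) _); apply: val_inj.
have := cross P hP; rewrite e0 e2.
case E : (phi (Some P)) => [[X Y]|] /= h.
  rewrite E /= in e0 e1 e2.
  have fE : f.[P.1] = X * g.[P.1].
    by apply: (mulfI lam0); apply/eqP; rewrite eq_sym -subr_eq0 -h; apply/eqP; ring.
  split=> //; apply/eqP => gP; rewrite gP mulr0 in fE.
  exact: (coprimep_evalP cfg fE gP).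
rewrite E /= !(mulr0, mulr1) in e0 e1 e2.
have wP : w P != 0 by rewrite /w e0 e1 e2 !(mulr0, expr0n, subr0) expf_neq0.
suff gP : g.[P.1] = 0.
  by split=> //; apply/eqP => fP; apply: (coprimep_evalP cfg fP gP).
have reg : regular A B (fun Q => g.[Q.1] * w Q - v0 Q ^+ 2 * f.[Q.1]).
  apply: regularD; first exact: regularM.
  by apply/regularN/regularM => //; apply: regularX.
have [|h0|h0] := regular_integral reg0 reg.
- move=> Q hQ; transitivity (w Q * (v0 Q * g.[Q.1] - v2 Q * f.[Q.1])
    + (v2 Q * w Q - v0 Q ^+ 3) * f.[Q.1]); first by ring.
  by rewrite cross // curve // subrr mulr0 mul0r addr0.
(* If v0 vanishes identically, so does v2, as [w] is nonzero at [P]. Then a generic point has v1 = 0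
   or goes to O, so v1 g vanishes identically, while v1 is nonzero at [P]. *)
- have [|h2|h2] := regular_integral reg2 regw.
  + by move=> Q hQ; rewrite curve // h0 // expr0n.
  + have [|h3|h3] := regular_integral (regularM reg1 regg) regn.
    * move=> Q hQ; have [->|nQ] := eqVneq n.[Q.1] 0; first by rewrite mulr0.
      have := gen Q hQ nQ; case: (chart Q hQ) => [[_ -> _]|[mu mu0 [_ _ e]]].
        by rewrite !mul0r.
      move: e; rewrite h2 //; case: (phi _) => [[X Y]|_ [-> _]] /=; last by rewrite mulr0 mul0r.
      by rewrite mulr1 => mu0'; rewrite -mu0' eqxx in mu0.
    * have /eqP := h3 P hP; rewrite e1 mulf_eq0 (negbTE lam0) => /eqP.
      by [].
    * have n00 : n = 0.
        apply: poly_eq0P => x; have [y hy] := exists_on_curve A B x.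
        exact: (h3 _ hy).
      by rewrite n00 eqxx in n0.
  + by move: wP; rewrite h2 // eqxx.
have /eqP := h0 P hP; rewrite e0 expr0n mul0r subr0 mulf_eq0 (negbTE wP) orbF.
by move/eqP.
Qed.

(** [f / g] is the generic fraction in lowest terms. The last clause is the curve equation with
    ordinate [b y / n]: the cubic at [f / g] is [cubic] times a square in L(x). *)
Lemma endo_xrep : exists f g : {poly L}, [/\ coprimep f g,
  (forall P, on_curve A B (Some P) -> xrep (phi (Some P)) f.[P.1] g.[P.1]) &
  g != 0 -> exists n b : {poly L}, n != 0 /\
    n ^+ 2 * (f ^+ 3 + A *: (f * g ^+ 2) + B *: g ^+ 3) = b ^+ 2 * cubic A B * g ^+ 3].
Proof.
have [n n0 [gen|[a [b gen]]]] := endo_generic.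
  exists 1, 0; split; rewrite ?eqxx ?coprime1p //.
  apply: (@xrep_extend 1 0 n) => [|//|P hP nP]; first exact: coprime1p.
  by rewrite gen // /xrep horner0 (_ : 1.[P.1] = 1) ?oner_eq0 // -[1]/(1%:P) hornerC.
pose h := gcdp a n.
have h0 : h != 0 by rewrite gcdp_eq0 (negbTE n0) andbF.
have [f fE] : exists f, a = f * h by exists (a %/ h); rewrite divpK ?dvdp_gcdl.
have [g gE] : exists g, n = g * h by exists (n %/ h); rewrite divpK ?dvdp_gcdr.
have cfg : coprimep f g.
  have : coprimep (a %/ h) (n %/ h) by rewrite coprimep_div_gcd // n0 orbT.
  by rewrite {1}fE gE !mulpK.
exists f, g; split=> //.
  apply: (xrep_extend cfg n0) => P hP nP; rewrite gen //=.
  move: nP; rewrite gE fE !hornerM mulf_eq0 negb_or => /andP[gP hP0].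
  by split=> //; rewrite invfM mulrACA divff // mulr1 divfK.
move=> g0; exists n, b; split=> //.
apply: (mulfI n0); apply: poly_eqP => x; have [y hy] := exists_on_curve A B x.
have [[stable _] _] := endo.
have [nx|nx] := eqVneq n.[x] 0; first by rewrite ![(n * _).[x]]hornerM nx !mul0r.
have := stable _ hy; rewrite gen //= => /eqP.
have fx : a.[x] / n.[x] = f.[x] / g.[x].
  move: nx; rewrite gE fE !hornerM mulf_eq0 negb_or => /andP[gx hx].
  by rewrite invfM mulrACA divff // mulr1.
have gx : g.[x] != 0 by move: nx; rewrite gE hornerM mulf_eq0 negb_or => /andP[].
move: hy; rewrite on_curveE fx => /eqP hy e; rewrite !(hornerM, hornerD, hornerZ, horner_exp).
congr (_ * _); rewrite -hy.
transitivity (n.[x] ^+ 2 * g.[x] ^+ 3 * ((b.[x] * y / n.[x]) ^+ 2)); last by field.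
by rewrite e; field.
Qed.

End XCoordinate.

(** * Heights and the Kummer map *)

Section Height.
Variable L : closedFieldType.

(** The largest degree in the tuple; for polynomials without common root, the height of the
    projective point they define over L(x). *)
Definition has_height (I : Type) (n : nat) (T : I -> {poly L}) :=
  (forall i, (size (T i) <= n.+1)%N) /\ exists i, (T i)`_n != 0.

Lemma has_height_uniq (I : Type) m n (T : I -> {poly L}) :
  has_height m T -> has_height n T -> m = n.
Proof.
have le k l : has_height k T -> has_height l T -> (k <= l)%N.
  move=> [_ [i hi]] [hl _]; rewrite leqNgt; apply: contra hi => kl.
  by rewrite nth_default // (leq_trans (hl i)).
by move=> hm hn; apply/eqP; rewrite eqn_leq !le.
Qed.

Lemma has_heightZ (I : Type) n (T G : I -> {poly L}) c : c != 0 ->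
  (forall i, T i = c *: G i) -> has_height n G -> has_height n T.
Proof.
move=> c0 e [h1 [i hi]]; split=> [j|]; first by rewrite e size_scale.
by exists i; rewrite e coefZ mulf_neq0.
Qed.

(** Both tuples represent the same projective point over L(x). Once their ratio is in lowest terms,
    a root of its numerator would be a common root of [T], and a root of its denominator one of
    [G]. *)
Lemma proportional (I : Type) (T G : I -> {poly L}) :
  (forall x, exists i, (T i).[x] != 0) ->
  (forall x, exists i, (G i).[x] != 0) ->
  (forall i j, T i * G j = T j * G i) ->
  exists2 c, c != 0 & forall i, T i = c *: G i.
Proof.
move=> hT hG hTG; have [i0 Gi0] := hG 0.
have G0 : G i0 != 0 by apply: contraNneq Gi0 => ->; rewrite horner0.
pose h := gcdp (T i0) (G i0).
have h0 : h != 0 by rewrite gcdp_eq0 (negbTE G0) andbF.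
have [t tE] : exists t, T i0 = t * h by exists (T i0 %/ h); rewrite divpK ?dvdp_gcdl.
have [g gE] : exists g, G i0 = g * h by exists (G i0 %/ h); rewrite divpK ?dvdp_gcdr.
have ctg : coprimep t g.
  have : coprimep (T i0 %/ h) (G i0 %/ h) by rewrite coprimep_div_gcd // G0 orbT.
  by rewrite {1}tE gE !mulpK.
have e j : t * G j = T j * g.
  by apply: (mulfI h0); rewrite mulrA [h * t]mulrC -tE hTG gE; ring.
have [x|ct ct0 tc] := @poly_size1P L t.
  apply/eqP => tx; have [j] := hT x; apply/negP; rewrite negbK.
  have := congr1 (fun q : {poly L} => q.[x]) (e j); rewrite !hornerM tx mul0r => /esym/eqP.
  by rewrite mulf_eq0 => /orP[//|/eqP gx]; case: (coprimep_evalP ctg tx gx).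
have [x|cg cg0 gc] := @poly_size1P L g.
  apply/eqP => gx; have [j] := hG x; apply/negP; rewrite negbK.
  have := congr1 (fun q : {poly L} => q.[x]) (e j); rewrite !hornerM gx mulr0 => /eqP.
  by rewrite mulf_eq0 => /orP[/eqP tx|//]; case: (coprimep_evalP ctg tx gx).
exists (ct / cg) => [|j]; first by rewrite mulf_neq0 ?invr_eq0.
have := e j; rewrite tc gc mul_polyC mulrC mul_polyC => h'.
by rewrite mulrC -scalerA h' scalerA mulVf // scale1r.
Qed.

Lemma size_mul_top (f g : {poly L}) m n : (size f <= m.+1)%N -> (size g <= n.+1)%N ->
  (size (f * g)%R <= (m + n).+1)%N.
Proof. by move=> hf hg; have := size_polyMleq f g; lia. Qed.

Lemma coef_mul_top (f g : {poly L}) m n : (size f <= m.+1)%N -> (size g <= n.+1)%N ->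
  (f * g)`_(m + n) = f`_m * g`_n.
Proof.
move=> hf hg; rewrite coefM.
have hm : (m < (m + n).+1)%N by rewrite ltnS leq_addr.
rewrite (bigD1 (Ordinal hm)) //= big1 ?addr0 ?addKn // => i im.
have [mi|im'] := ltnP m i.
  by rewrite nth_default ?mul0r // (leq_trans hf).
rewrite [X in _ * X]nth_default ?mulr0 // (leq_trans hg) //.
have := ltn_ord i; have : (i : nat) != m by [].
by lia.
Qed.

Definition pair2 (R : Type) (f g : R) : bool -> R := fun b => if b then f else g.
Definition tri (R : zmodType) (a b c : R) : 'I_3 -> R := fun i => nth 0 [:: a; b; c] i.

Lemma triP (R : zmodType) (a b c : R) (Q : R -> Prop) :
  (exists i, Q (tri a b c i)) <-> [\/ Q a, Q b | Q c].
Proof.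
split=> [[[[|[|[|//]]] hi]]|[h|h|h]]; rewrite /tri /=.
- by constructor 1.
- by constructor 2.
- by constructor 3.
- by exists (Ordinal (isT : (0 < 3)%N)).
- by exists (Ordinal (isT : (1 < 3)%N)).
- by exists (Ordinal (isT : (2 < 3)%N)).
Qed.

Lemma tri_all (R : zmodType) (a b c : R) (Q : R -> Prop) :
  Q a -> Q b -> Q c -> forall i, Q (tri a b c i).
Proof. by move=> ? ? ? [[|[|[|//]]]]. Qed.

Section Forms.
Variable R : comNzRingType.

(** The symmetric square of the projective line is the plane: these are the coefficients of (g1 T +
    f1)(g2 T + f2). *)
Definition sym2 (f1 g1 f2 g2 : R) := (g1 * g2, f1 * g2 + f2 * g1, f1 * f2).

(* (W : S : P) = (1 : x1 + x2 : x1 x2) at a pair {P, Q} is sent to the same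
   triple at {P + Q, P - Q}. *)
Definition kum0 (r : R * R * R) := let: (w, s, t) := r in s ^+ 2 - 4%:R * t * w.
Definition kum1 (A B : R) (r : R * R * R) := let: (w, s, t) := r in
  2%:R * s * (A * w + t) + 4%:R * B * w ^+ 2.
Definition kum2 (A B : R) (r : R * R * R) := let: (w, s, t) := r in
  (t - A * w) ^+ 2 - 4%:R * B * s * w.
End Forms.

Lemma sym2_neq0 (f1 g1 f2 g2 : L) :
  (f1 != 0) || (g1 != 0) -> (f2 != 0) || (g2 != 0) ->
  [\/ g1 * g2 != 0, f1 * g2 + f2 * g1 != 0 | f1 * f2 != 0].
Proof.
have [->|g10] := eqVneq g1 0; have [->|g20] := eqVneq g2 0; rewrite ?orbF ?orbT => h1 h2.
- by constructor 3; rewrite mulf_neq0.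
- by constructor 2; rewrite mulr0 addr0 mulf_neq0.
- by constructor 2; rewrite mulr0 add0r mulf_neq0.
- by constructor 1; rewrite mulf_neq0.
Qed.

Section Kummer.
Variables A B : L.
Hypothesis two0 : 2%:R != 0 :> L.
Hypothesis ns : ec_nonsing A B.

(** [kum0] is the discriminant of the pair, so its zeros are double points. At a finite double point
    x, up to scaling, [kum1] is 4h(x) for h = X^3 + AX + B and, when h(x) = 0, [kum2] is h'(x)^2: a
    common zero is a double root of h. At infinity [kum2] is nonzero. *)
Lemma kum_neq0 (f1 g1 f2 g2 : L) (r := sym2 f1 g1 f2 g2) :
  (f1 != 0) || (g1 != 0) -> (f2 != 0) || (g2 != 0) ->
  [\/ kum0 r != 0, kum1 A B r != 0 | kum2 A B r != 0].
Proof.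
move=> h1 h2; have [k0|] := eqVneq (kum0 r) 0; last by constructor 1.
have [k1|] := eqVneq (kum1 A B r) 0; last by constructor 2.
constructor 3; apply/eqP => k2; move: k0 k1 k2; rewrite /r /=.
have four0 : 4%:R != 0 :> L by rewrite (_ : 4%:R = 2%:R * 2%:R :> L) ?mulf_neq0 //; ring.
move=> k0; have {k0} /eqP k0 : (f1 * g2 - f2 * g1) ^+ 2 = 0 by rewrite -[RHS]k0; ring.
move: k0; rewrite expf_eq0 /= subr_eq0 => /eqP k0.
have [g10|g10] := eqVneq g1 0.
  move: h1 k0; rewrite g10 eqxx orbF mulr0 => f10 /eqP.
  rewrite mulf_eq0 (negbTE f10) => /eqP g20; move: h2; rewrite g20 eqxx orbF => f20 _.
  rewrite !(mul0r, mulr0, subr0) => /eqP.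
  by rewrite expf_eq0 mulf_eq0 (negbTE f10) (negbTE f20).
have g20 : g2 != 0.
  apply: contra_neq g10 => g20; move: k0 h2; rewrite g20 mulr0 eqxx orbF => /esym/eqP.
  by rewrite mulf_eq0 => /orP[/eqP-> /eqP //|/eqP].
have [x f1E] : exists x, f1 = x * g1 by exists (f1 / g1); rewrite divfK.
have f2E : f2 = x * g2 by apply: (mulIf g10); rewrite -k0 f1E; ring.
rewrite f1E f2E => k1 k2.
have F0 : x ^+ 3 + A * x + B = 0.
  apply: (mulfI (mulf_neq0 four0 (expf_neq0 2 (mulf_neq0 g10 g20)))).
  by rewrite mulr0 -[RHS]k1; ring.
have BE : B = - x ^+ 3 - A * x by rewrite -[LHS]addr0 -[X in _ + X]oppr0 -F0; ring.
have /eqP : (3%:R * x ^+ 2 + A) ^+ 2 = 0.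
  apply: (mulfI (expf_neq0 2 (mulf_neq0 g10 g20))).
  by rewrite mulr0 -[RHS]k2 BE; ring.
rewrite expf_eq0 /= addr_eq0 => /eqP h.
have AE : A = - (3%:R * x ^+ 2) by rewrite h opprK.
by move/eqP: ns; apply; rewrite BE AE; ring.
Qed.

Lemma kummer_add P Q f1 g1 f2 g2 f3 g3 f4 g4
  (r := sym2 f1 g1 f2 g2) (r' := sym2 f3 g3 f4 g4) :
  on_curve A B P -> on_curve A B Q ->
  xrep P f1 g1 -> xrep Q f2 g2 -> xrep (ec_add A P Q) f3 g3 ->
  xrep (ec_add A P (pt_opp Q)) f4 g4 ->
  forall i j, tri r'.1.1 r'.1.2 r'.2 i * tri (kum0 r) (kum1 A B r) (kum2 A B r) j
            = tri r'.1.1 r'.1.2 r'.2 j * tri (kum0 r) (kum1 A B r) (kum2 A B r) i.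
Proof.
move=> hP hQ h1 h2 h3 h4.
suff [e1 e2 e3] : [/\ r'.1.1 * kum1 A B r = r'.1.2 * kum0 r,
    r'.1.1 * kum2 A B r = r'.2 * kum0 r & r'.1.2 * kum2 A B r = r'.2 * kum1 A B r].
  by case=> [[|[|[|//]]] hi] [[|[|[|//]]] hj]; rewrite /tri /=.
move: hP hQ h1 h2 h3 h4; rewrite {}/r {}/r'.
case: P => [[x1 y1]|] /=; last first.
  case: Q => [[x2 y2]|] _ hQ [-> f10] /=.
    by move=> [_ ->] [_ ->] [_ ->]; split; ring.
  by move=> [-> _] [-> _] [-> _]; split; ring.
case: Q => [[x2 y2]|] hP hQ [_ ->] /=; last first.
  by move=> [-> _] [_ ->] [_ ->]; split; ring.
move=> [_ ->]; rewrite opprK.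
(* The equation of [P] eliminates [B]; if the abscissae differ, that of [Q] eliminates [A]. *)
have BE : B = y1 ^+ 2 - x1 ^+ 3 - A * x1 by rewrite (eqP hP); ring.
have [x12|x12] := eqVneq x1 x2 => /=; last first.
  move=> [_ ->] [_ ->].
  have d0 : x2 - x1 != 0 by rewrite subr_eq0 eq_sym.
  have AE : A = (y2 ^+ 2 - y1 ^+ 2 - x2 ^+ 3 + x1 ^+ 3) / (x2 - x1).
    by apply: (mulIf d0); rewrite divfK // (eqP hP) (eqP hQ); ring.
  by rewrite BE AE; split; field.
rewrite -{}x12 in hQ *.
(* Equal abscissae mean [Q = P] or [Q = -P]: one of sum and difference is O, and the other is a
   doubling, which is O as well when [y1] is 0. *)
have : (y2 == y1) || (y2 == - y1) by rewrite -eqf_sqr (eqP hP) (eqP hQ).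
case/orP=> /eqP ->.
  rewrite !eqxx /=; have [y0|y0] := eqVneq y1 (- y1) => /=.
    move=> [-> _] [-> _].
    have {}y0 : y1 = 0.
      by apply: (mulfI two0); rewrite mulr0 mulr2n mulrDl mul1r {1}y0 addNr.
    by rewrite BE y0; split; ring.
  have y10 : y1 != 0 by apply: contra_neq y0 => ->; rewrite oppr0.
  by move=> [_ ->] [-> _]; rewrite BE; split; field; rewrite ?two0 ?y10.
rewrite opprK !eqxx /=; have [y0|y0] := eqVneq y1 (- y1) => /=.
  move=> [-> _] [-> _].
  have {}y0 : y1 = 0.
    by apply: (mulfI two0); rewrite mulr0 mulr2n mulrDl mul1r {1}y0 addNr.
  by rewrite BE y0; split; ring.
have y10 : y1 != 0 by apply: contra_neq y0 => ->; rewrite oppr0.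
by move=> [-> _] [_ ->]; rewrite BE; split; field; rewrite ?two0 ?y10.
Qed.

End Kummer.
End Height.

(** * Parallelogram law and multiplicativity of heights *)

Section HeightLaws.
Variable L : closedFieldType.
Implicit Types f g : {poly L}.

(* t is the value of f at infinity, f being seen as a form of degree n. *)
Definition top_spec n f (t : L) := (size f <= n.+1)%N /\ f`_n = t.

Lemma topD n f g s t : top_spec n f s -> top_spec n g t -> top_spec n (f + g) (s + t).
Proof.
move=> [hf <-] [hg <-]; split; last by rewrite coefD.
by rewrite (leq_trans (size_polyD _ _)) // geq_max hf.
Qed.

Lemma topN n f t : top_spec n f t -> top_spec n (- f) (- t).
Proof. by move=> [hf <-]; split; rewrite ?size_polyN // coefN. Qed.

Lemma topM m n f g s t : top_spec m f s -> top_spec n g t -> top_spec (m + n) (f * g) (s * t).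
Proof. by move=> [hf <-] [hg <-]; split; [apply: size_mul_top | apply: coef_mul_top]. Qed.

Lemma topX m k f s : top_spec m f s -> top_spec (m * k) (f ^+ k) (s ^+ k).
Proof.
move=> h; elim: k => [|k IH]; first by rewrite muln0; split; rewrite ?size_poly1 // coefC.
by rewrite !exprS mulnS; apply: topM.
Qed.

Lemma topC c : top_spec 0 (c%:P) c.
Proof. by split; rewrite ?size_polyC_leq1 // coefC. Qed.

Lemma topnat k : top_spec 0 (k%:R : {poly L}) k%:R.
Proof. by rewrite -polyC_natr; apply: topC. Qed.

Lemma has_height_tri n f g h s t r : top_spec n f s -> top_spec n g t -> top_spec n h r ->
  [\/ s != 0, t != 0 | r != 0] -> has_height n (tri f g h).
Proof.
move=> [hf <-] [hg <-] [hh <-] nz; split.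
  by apply: (tri_all (Q := fun q : {poly L} => (size q <= n.+1)%N)).
by apply/(triP f g h (fun q => is_true (q`_n != 0))).
Qed.

Lemma has_height_pair n f g s t : top_spec n f s -> top_spec n g t ->
  (s != 0) || (t != 0) -> has_height n (pair2 f g).
Proof.
by move=> [hf <-] [hg <-] /orP nz; split; [case | case: nz; [exists true | exists false]].
Qed.

Lemma has_heightP n f g : has_height n (pair2 f g) ->
  [/\ top_spec n f f`_n, top_spec n g g`_n & (f`_n != 0) || (g`_n != 0)].
Proof.
move=> [h [b hb]]; split; [exact: (conj (h true)) | exact: (conj (h false)) |].
by case: b hb => /= ->; rewrite ?orbT.
Qed.

Lemma has_height_exists f g : (f != 0) || (g != 0) -> exists n, has_height n (pair2 f g).
Proof.
move=> nz; have [le|lt] := leqP (size g) (size f).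
  exists (size f).-1; split=> [b|].
    by rewrite (leq_trans _ (leqSpred _)) //; case: b.
  exists true; rewrite /= -/(lead_coef f) lead_coef_eq0; apply: contraTneq nz => f0.
  by move: le; rewrite f0 size_poly0 leqn0 size_poly_eq0 eqxx => /eqP->; rewrite eqxx.
exists (size g).-1; split=> [b|].
  by rewrite (leq_trans _ (leqSpred _)) //; case: b => //=; apply: ltnW.
exists false; rewrite /= -/(lead_coef g) lead_coef_eq0.
by rewrite -size_poly_gt0 (leq_ltn_trans _ lt).
Qed.

Lemma coprime_horner f g x : coprimep f g -> (f.[x] != 0) || (g.[x] != 0).
Proof.
by move=> cfg; rewrite -negb_and; apply/negP => /andP[/eqP h1 /eqP]; apply: (coprimep_evalP cfg h1).
Qed.

(** The two triples are proportional and neither has a common root, so they differ by a constant and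
    have the same height: [n3 + n4] for the first, twice [n1 + n2] for the second, which is
    quadratic in a triple of height [n1 + n2]. That the leading values do not all vanish is
    [sym2_neq0] and [kum_neq0] at infinity. *)
Lemma height_parallelogram (A B : L) f1 g1 f2 g2 f3 g3 f4 g4 n1 n2 n3 n4 :
  2%:R != 0 :> L -> ec_nonsing A B ->
  coprimep f1 g1 -> coprimep f2 g2 -> coprimep f3 g3 -> coprimep f4 g4 ->
  has_height n1 (pair2 f1 g1) -> has_height n2 (pair2 f2 g2) ->
  has_height n3 (pair2 f3 g3) -> has_height n4 (pair2 f4 g4) ->
  (forall x, let r := sym2 f1.[x] g1.[x] f2.[x] g2.[x] in
     let r' := sym2 f3.[x] g3.[x] f4.[x] g4.[x] in
   forall i j, tri r'.1.1 r'.1.2 r'.2 i * tri (kum0 r) (kum1 A B r) (kum2 A B r) j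
            = tri r'.1.1 r'.1.2 r'.2 j * tri (kum0 r) (kum1 A B r) (kum2 A B r) i) ->
  (n3 + n4 = 2 * n1 + 2 * n2)%N.
Proof.
move=> two0 ns c1 c2 c3 c4 h1 h2 h3 h4 H.
pose r := sym2 f1 g1 f2 g2; pose r' := sym2 f3 g3 f4 g4.
pose T := tri r'.1.1 r'.1.2 r'.2.
pose G := tri (kum0 r) (kum1 A%:P B%:P r) (kum2 A%:P B%:P r).
have evT x i : (T i).[x] = let r' := sym2 f3.[x] g3.[x] f4.[x] g4.[x] in
    tri r'.1.1 r'.1.2 r'.2 i.
  by case: i => [[|[|[|//]]] hi]; rewrite /T /tri /= !hornerE.
have evG x i : (G i).[x] = let r := sym2 f1.[x] g1.[x] f2.[x] g2.[x] in
    tri (kum0 r) (kum1 A B r) (kum2 A B r) i.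
  by case: i => [[|[|[|//]]] hi]; rewrite /G /tri /= -!polyC_natr !hornerE.
have [x|x|i j|c c0 TG] := @proportional L _ T G.
- have := sym2_neq0 (coprime_horner x c3) (coprime_horner x c4).
  by move/(triP _ _ _ (fun q : L => is_true (q != 0))) => [i hi]; exists i; rewrite evT.
- have := kum_neq0 two0 ns (coprime_horner x c1) (coprime_horner x c2).
  by move/(triP _ _ _ (fun q : L => is_true (q != 0))) => [i hi]; exists i; rewrite evG.
- by apply: poly_eqP => x; rewrite !hornerM !evT !evG; apply: H.
have [t1 s1 z1] := has_heightP h1; have [t2 s2 z2] := has_heightP h2.
have [t3 s3 z3] := has_heightP h3; have [t4 s4 z4] := has_heightP h4.
have hT : has_height (n3 + n4) T.
  apply: has_height_tri (sym2_neq0 z3 z4); first exact: topM.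
    by apply: topD; [| rewrite addnC]; apply: topM.
  exact: topM.
have hr1 : top_spec (n1 + n2) r.1.1 (g1`_n1 * g2`_n2) by apply: topM.
have hr2 : top_spec (n1 + n2) r.1.2 (f1`_n1 * g2`_n2 + f2`_n2 * g1`_n1).
  by apply: topD; [| rewrite addnC]; apply: topM.
have hr3 : top_spec (n1 + n2) r.2 (f1`_n1 * f2`_n2) by apply: topM.
have hG : has_height ((n1 + n2) * 2) G.
  have hA := topM (topC A) hr1; rewrite add0n in hA.
  have k0 := topM (topM (topnat 4) hr3) hr1.
  have k1 := topM (topM (topnat 2) hr2) (topD hA hr3).
  have k1' := topM (topM (topnat 4) (topC B)) (topX 2 hr1).
  have k2 := topX 2 (topD hr3 (topN hA)).
  have k2' := topM (topM (topM (topnat 4) (topC B)) hr2) hr1.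
  rewrite !add0n ?addnn -?muln2 in k0 k1 k1' k2'.
  exact: (has_height_tri (topD (topX 2 hr2) (topN k0)) (topD k1 k1') (topD k2 (topN k2'))
    (kum_neq0 two0 ns z1 z2)).
have := has_height_uniq hT (has_heightZ c0 TG hG); clear; lia.
Qed.

Section Composition.
Variable R : comNzRingType.

(** The homogenization of [f] in degree [n]. The map [iota] on coefficients lets it be evaluated
    both at scalars and at polynomials. *)
Definition hom_form (iota : L -> R) (f : {poly L}) n (x z : R) :=
  \sum_(i < n.+1) iota f`_i * x ^+ i * z ^+ (n - i).
End Composition.

Lemma hom_form_eval f n (x z : L) : (size f <= n.+1)%N -> z != 0 ->
  hom_form id f n x z = z ^+ n * f.[x / z].
Proof.
move=> hf z0; rewrite (horner_coef_wide _ hf) mulr_sumr; apply: eq_bigr => i _.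
have -> : z ^+ n = z ^+ i * z ^+ (n - i) by rewrite -exprD subnKC // -ltnS.
by rewrite exprMn exprVn; field; rewrite expf_neq0.
Qed.

Lemma hom_form_eval0 f n (x : L) : hom_form id f n x 0 = f`_n * x ^+ n.
Proof.
rewrite /hom_form big_ord_recr /= subnn expr0 mulr1 big1 ?add0r // => i _.
by rewrite expr0n subn_eq0 leqNgt ltn_ord mulr0.
Qed.

Lemma hom_form_neq0 f g n (x z : L) : coprimep f g -> has_height n (pair2 f g) ->
  (x != 0) || (z != 0) -> (hom_form id f n x z != 0) || (hom_form id g n x z != 0).
Proof.
move=> cfg /has_heightP [[hf _] [hg _] nz].
have [->|z0] := eqVneq z 0.
  by rewrite orbF => x0; rewrite !hom_form_eval0 !mulf_eq0 !(negbTE (expf_neq0 _ x0)) !orbF.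
by rewrite !hom_form_eval // !mulf_eq0 !(negbTE (expf_neq0 _ z0)) /= coprime_horner.
Qed.

Lemma hom_form_horner f n (u v : {poly L}) x :
  (hom_form polyC f n u v).[x] = hom_form id f n u.[x] v.[x].
Proof. by rewrite horner_sum; apply: eq_bigr => i _; rewrite !(hornerM, hornerC, horner_exp). Qed.

Lemma hom_form_top f n m (u v : {poly L}) s t : top_spec m u s -> top_spec m v t ->
  top_spec (m * n) (hom_form polyC f n u v) (hom_form id f n s t).
Proof.
move=> hu hv; rewrite /hom_form.
elim/big_ind2: _ => [||i _]; first by split; rewrite ?size_poly0 // coef0.
  by move=> *; apply: topD.
have -> : (m * n)%N = (0 + m * i + m * (n - i))%N.
  by rewrite add0n -mulnDr subnKC // -ltnS.
by apply: topM; [apply: topM; [apply: topC | apply: topX] | apply: topX].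
Qed.

(** Substituting [f2, g2] into the homogenized [f1, g1] gives a pair without common zero, even at
    infinity, of height [n1 * n2]; it is proportional to [f3, g3]. *)
Lemma height_comp f1 g1 f2 g2 f3 g3 n1 n2 n3 (n : {poly L}) :
  coprimep f1 g1 -> coprimep f2 g2 -> coprimep f3 g3 ->
  has_height n1 (pair2 f1 g1) -> has_height n2 (pair2 f2 g2) ->
  has_height n3 (pair2 f3 g3) -> n != 0 ->
  (forall x, n.[x] != 0 -> g2.[x] != 0 /\
     f3.[x] * g1.[f2.[x] / g2.[x]] = g3.[x] * f1.[f2.[x] / g2.[x]]) ->
  n3 = (n1 * n2)%N.
Proof.
move=> c1 c2 c3 h1 h2 h3 n0 H.
pose G := pair2 (hom_form polyC f1 n1 f2 g2) (hom_form polyC g1 n1 f2 g2).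
have [[sf1 _] [sg1 _] _] := has_heightP h1.
have [t2 s2 z2] := has_heightP h2.
have e : f3 * G false = g3 * G true.
  apply: (mulfI n0); apply: poly_eqP => x; rewrite ![(n * _).[x]]hornerM.
  have [->|nx] := eqVneq n.[x] 0; first by rewrite !mul0r.
  have [gx ex] := H x nx; rewrite !hornerM !hom_form_horner !hom_form_eval //.
  by congr (_ * _); rewrite mulrCA ex mulrCA.
have [x|x|i j|c c0 TG] := @proportional L _ (pair2 f3 g3) G.
- by have /orP[h|h] := coprime_horner x c3; [exists true | exists false].
- have /orP[h|h] := hom_form_neq0 c1 h1 (coprime_horner x c2).
    by exists true; rewrite /= hom_form_horner.
  by exists false; rewrite /= hom_form_horner.
- by case: i j => [] [] //=; rewrite e.
have hG : has_height (n2 * n1) G.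
  by apply: (has_height_pair _ _ (hom_form_neq0 c1 h1 z2)); apply: hom_form_top.
by rewrite mulnC; apply: has_height_uniq h3 (has_heightZ c0 TG hG).
Qed.

End HeightLaws.

(** * Polynomial isogenies in characteristic p *)

Section Frobenius.

Lemma frobeniusD (R : comNzRingType) p (x y : R) : p \in [pchar R] ->
  (x + y) ^+ p = x ^+ p + y ^+ p.
Proof. by move=> hp; apply: (pFrobenius_autD_comm hp); apply: mulrC. Qed.

Lemma frobenius_nat (R : comNzRingType) p n : p \in [pchar R] ->
  (n%:R : R) ^+ p = n%:R.
Proof. by move=> hp; apply: (pFrobenius_aut_nat hp). Qed.

Lemma frobenius_sum (R : comNzRingType) p n (f : 'I_n -> R) : p \in [pchar R] ->
  (\sum_i f i) ^+ p = \sum_i f i ^+ p.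
Proof.
move=> hp; have p0 : (0 < p)%N by case/andP: hp => /prime_gt0.
elim/big_rec2: _ => [|i x y _ <-]; first by rewrite expr0n gtn_eqF.
exact: frobeniusD.
Qed.

Variables (L : closedFieldType) (p : nat).
Hypotheses (hchar : p \in [pchar L]) (hp3 : (3 < p)%N).

Lemma nat_neq0 n : (0 < n < p)%N -> n%:R != 0 :> L.
Proof. by move=> h; rewrite -(dvdn_pcharf hchar) gtnNdvd //; case/andP: h. Qed.

(** Only coefficients of index divisible by p survive, each has a p-th root in [L], and the
    Frobenius is additive. *)
Lemma pth_root_of_deriv0 (R : {poly L}) : R^`() = 0 -> exists S, R = S ^+ p.
Proof.
move=> dR; have p_pr : prime p by case/andP: hchar.
have p0 := prime_gt0 p_pr.
have hP : p \in [pchar {poly L}] by rewrite pchar_poly.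
have coef0 i : ~~ (p %| i)%N -> R`_i = 0.
  case: i => [|i]; first by rewrite dvdn0.
  rewrite (dvdn_pcharf hchar) => /negbTE hi.
  have /eqP := congr1 (fun q : {poly L} => q`_i) dR.
  by rewrite coef_deriv coef0 -mulr_natr mulf_eq0 hi orbF => /eqP.
have [rt hrt] : exists rt : L -> L, forall c, rt c ^+ p = c.
  by apply: (functional_choice (fun c y : L => y ^+ p = c)) => c; have [y hy] := closed_field_root c p0; exists y.
exists (\sum_(i < size R) rt R`_i *: 'X^(i %/ p)).
rewrite frobenius_sum // -{1}[R]coefK poly_def; apply: eq_bigr => i _.
rewrite exprZn hrt -exprM; have [d|nd] := boolP (p %| i)%N; first by rewrite divnK.
by rewrite coef0 // !scale0r.
Qed.

Lemma nonsing_root (A B x : L) : ec_nonsing A B ->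
  x ^+ 3 + A * x + B = 0 -> 3%:R * x ^+ 2 + A = 0 -> False.
Proof.
move=> ns h1 /eqP; rewrite addrC addr_eq0 => /eqP AE; move/eqP: ns; apply.
have -> : B = 2%:R * x ^+ 3 by rewrite -[LHS]addr0 -[X in _ + X]oppr0 -h1 AE; ring.
by rewrite AE; ring.
Qed.

Lemma cubic_separable (A B : L) : ec_nonsing A B ->
  coprimep (cubic A B) (cubic A B)^`().
Proof.
move=> ns; apply: coprimep_closed => x; rewrite cubicE => h1 h2.
apply: (nonsing_root ns h1); rewrite -[RHS]h2.
by rewrite [cubic _ _]unlock !derivD derivXn derivZ derivX derivC !hornerE /=; ring.
Qed.

(** After cancelling the gcd of [n] and [s], the square of what is left of [n] divides the
    squarefree [F], so it is constant. *)
Lemma sqr_dvd_separable (F n T s : {poly L}) : coprimep F F^`() -> n != 0 ->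
  n ^+ 2 * T = s ^+ 2 * F -> exists2 r, s = n * r & T = F * r ^+ 2.
Proof.
move=> sepF n0 e; pose h := gcdp n s.
have h0 : h != 0 by rewrite gcdp_eq0 (negbTE n0).
have [n' nE] : exists n', n = n' * h by exists (n %/ h); rewrite divpK ?dvdp_gcdl.
have [s' sE] : exists s', s = s' * h by exists (s %/ h); rewrite divpK ?dvdp_gcdr.
have cns : coprimep n' s'.
  have : coprimep (n %/ h) (s %/ h) by rewrite coprimep_div_gcd // n0.
  by rewrite {1}nE sE !mulpK.
have e' : n' ^+ 2 * T = s' ^+ 2 * F.
  apply: (mulfI (expf_neq0 2 h0)); transitivity ((n' * h) ^+ 2 * T); first by ring.
  by rewrite -nE e sE; ring.
have [x|c c0 n'E] := @poly_size1P L n'.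
  apply/eqP => nx; have : n' ^+ 2 %| F.
    rewrite -(@Gauss_dvdpr _ _ (s' ^+ 2)) ?coprimep_expl ?coprimep_expr //.
    by rewrite -e' dvdp_mulr.
  case/dvdpP => q FE; apply: (coprimep_evalP sepF (x := x)).
    by rewrite FE hornerM horner_exp nx expr0n mulr0.
  by rewrite FE expr2 !derivM !(hornerD, hornerM) nx !(mulr0, mul0r, addr0).
have K : c%:P * (c^-1 *: s') = s' by rewrite mul_polyC scalerA divff // scale1r.
exists (c^-1 *: s'); first by rewrite nE sE n'E mulrAC K.
apply: (mulfI (expf_neq0 2 n0)); transitivity (s' ^+ 2 * h ^+ 2 * F).
  by rewrite e sE; ring.
rewrite -{1}K nE n'E; ring.
Qed.

(* A polynomial x-coordinate R satisfies R^3 + A' R + B' = F s^2. Comparing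
   derivatives gives s | R', and deg s = 3 (deg R - 1) / 2 then forces R' = 0,
   so R is a p-th power and one descends. *)
Lemma polynomial_isogeny (A B : L) : ec_nonsing A B -> forall (A' B' : L) (R s : {poly L}),
  ec_nonsing A' B' -> (1 < size R)%N ->
  R ^+ 3 + A' *: R + B'%:P = cubic A B * s ^+ 2 ->
  exists k, exists2 c, c != 0 &
    [/\ R = c *: 'X^(p ^ k), A' = c ^+ 2 * A ^+ (p ^ k) & B' = c ^+ 3 * B ^+ (p ^ k)].
Proof.
move=> ns A' B' R s; have [m] := ubnP (size R); elim: m => // m IH in A' B' R s *.
rewrite ltnS => leR ns' sR e.
have R0 : R != 0 by rewrite -size_poly_gt0 (leq_ltn_trans _ sR).
have szT : size (R ^+ 3 + A' *: R + B'%:P) = (3 * (size R).-1).+1.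
  have sz3 : size (R ^+ 3) = (3 * (size R).-1).+1.
    have h : (0 < size (R ^+ 3)%R)%N by rewrite size_poly_gt0 expf_neq0.
    by rewrite -(prednK h) size_exp mulnC.
  rewrite -addrA size_polyDl sz3 // (leq_ltn_trans (size_polyD _ _)) // gtn_max.
  rewrite (leq_ltn_trans (size_scale_leq _ _)) ?(leq_ltn_trans (size_polyC_leq1 _)) //.
    by rewrite ltnS; move: (size R) sR; clear; lia.
  by move: (size R) sR; clear; lia.
have s0 : s != 0.
  apply/eqP => s0; move: szT; rewrite e s0 expr0n mulr0 size_poly0 => /eqP.
  by [].
have szs : (2 * (size s).-1 = 3 * (size R).-1 - 3)%N.
  move: szT; rewrite e expr2 !size_mul ?mulf_neq0 ?cubic_neq0 // size_cubic.
  move: s0; rewrite -size_poly_gt0; move: (size s) (size R); clear; lia.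
have [s2|s2] := leqP (size R) 2.
  have szR : size R = 2%N by apply/eqP; rewrite eqn_leq s2.
  have : size s == 1%N.
    move: szs s0; rewrite szR -size_poly_gt0; clear; lia.
  case/size_poly1P => t t0 sE; exists 0%N; rewrite expn0 !expr1.
  pose al := R`_1; pose be := R`_0.
  have al0 : al != 0 by have := lead_coef_eq0 R; rewrite lead_coefE szR /= (negbTE R0) => ->.
  have RE : R = al *: 'X + be%:P.
    apply/polyP => -[|[|i]]; rewrite coefD coefZ coefX coefC /= ?(mulr0, mulr1, add0r, addr0) //.
    by rewrite nth_default // szR.
  (* In degree 1 coefficients are compared: the X^2 term kills [be], since 3 is invertible, and the
     X^3 term gives t^2 = al^3. *)
  have {}e : al ^+ 3 *: 'X^3 + (3%:R * al ^+ 2 * be) *: 'X^2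
      + (3%:R * al * be ^+ 2 + A' * al) *: 'X + (be ^+ 3 + A' * be + B')%:P
      = t ^+ 2 *: 'X^3 + (t ^+ 2 * A) *: 'X + (t ^+ 2 * B)%:P.
    apply: poly_eqP => x; have := congr1 (fun q : {poly L} => q.[x]) e.
    rewrite RE sE !(hornerM, hornerD, horner_exp, hornerC, hornerZ, hornerX, hornerXn) cubicE => h.
    transitivity ((al * x + be) ^+ 3 + A' * (al * x + be) + B'); first by ring.
    by rewrite h; ring.
  have e3 := congr1 (fun q : {poly L} => q`_3) e.
  have e2 := congr1 (fun q : {poly L} => q`_2) e.
  have e1 := congr1 (fun q : {poly L} => q`_1) e.
  have e0 := congr1 (fun q : {poly L} => q`_0) e.
  move: e3 e2 e1 e0; rewrite !(coefD, coefZ, coefXn, coefX, coefC) /=.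
  rewrite !(mulr0, mulr1, add0r, addr0) => e3 /eqP; rewrite !mulf_eq0 ?expf_eq0 /=.
  rewrite (negbTE al0) (negbTE (@nat_neq0 3 _)) //= => /eqP be0.
  rewrite be0 !expr0n /= !(mulr0, add0r) -e3 => e1 e0.
  exists al => //; split=> //; first by rewrite RE be0 addr0.
  by apply: (mulIf al0); rewrite e1; ring.
have dR : R^`() = 0.
  (* At a common root, the value of [R] would be a double root of X^3 + A'X + B'. *)
  have cop : coprimep s (3%:R *: R ^+ 2 + A'%:P).
    apply: coprimep_closed => x sx; rewrite !(hornerM, hornerD, horner_exp, hornerC, hornerZ) => h.
    apply: (nonsing_root ns' _ h).
    have := congr1 (fun q : {poly L} => q.[x]) e.
    rewrite !(hornerM, hornerD, horner_exp, hornerC, hornerZ) sx !(expr0n, mulr0) => <-.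
    by [].
  have dv : s %| R^`().
    rewrite -(Gauss_dvdpr _ cop).
    have -> : (3%:R *: R ^+ 2 + A'%:P) * R^`() = (R ^+ 3 + A' *: R + B'%:P)^`().
      rewrite !(derivD, derivZ, derivC, derivX, derivXn) deriv_exp /= addr0.
      by rewrite -!mul_polyC polyC_natr -mulr_natl; ring.
    rewrite e expr2 !derivM; apply/dvdpP.
    exists ((cubic A B)^`() * s + 2%:R * cubic A B * s^`()).
    by ring.
  apply: contraTeq dv => dR0; apply/negP => /(dvdp_leq dR0).
  have := lt_size_deriv R0; move: szs s2; move: (size s) (size R) (size R^`()); clear; lia.
have [S RE] := pth_root_of_deriv0 dR.
have p_pr : prime p by case/andP: hchar.
have p0 := prime_gt0 p_pr.
have hP : p \in [pchar {poly L}] by rewrite pchar_poly.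
have [A1 A1E] := closed_field_root A' p0; have [B1 B1E] := closed_field_root B' p0.
pose T1 := S ^+ 3 + A1 *: S + B1%:P.
have TE : R ^+ 3 + A' *: R + B'%:P = T1 ^+ p.
  rewrite /T1 !frobeniusD // exprZn A1E -polyC_exp B1E RE.
  by rewrite -!exprM mulnC.
have T10 : T1 != 0.
  apply/eqP => T10; move: szT; rewrite TE T10 expr0n gtn_eqF // size_poly0.
  by [].
(* As p is odd, [T1 ^+ p] is [T1] times a square; since it equals [cubic A B] times a square, so
   does [T1] itself by separability. *)
have pE : p = (p./2 * 2).+1.
  have := odd_double_half p; case: (even_prime p_pr) => [p2|->]; first by move: hp3; rewrite p2.
  by rewrite -muln2.
have [||r _ T1E] := @sqr_dvd_separable (cubic A B) (T1 ^+ p./2) T1 s (cubic_separable ns).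
- by rewrite expf_neq0.
- by rewrite -exprM -exprSr -pE -TE e mulrC.
have szS : ((size R).-1 = (size S).-1 * p)%N by rewrite RE size_exp.
have [||||k [c c0 [SE AE BE]]] := IH A1 B1 S r.
- by move: szS sR leR hp3; move: (size S) (size R); clear; nia.
- apply/eqP => z; move/eqP: ns'; apply.
  have <- : (4%:R * A1 ^+ 3 + 27%:R * B1 ^+ 2) ^+ p = 4%:R * A' ^+ 3 + 27%:R * B' ^+ 2.
    by rewrite frobeniusD // ![(_%:R * _) ^+ p]exprMn !frobenius_nat // -A1E -B1E !(exprAC _ p).
  by rewrite z expr0n gtn_eqF.
- by move: szS sR; move: (size S) (size R); clear; nia.
- by [].
exists k.+1, (c ^+ p); first by rewrite expf_neq0.
split.
- by rewrite RE SE exprZn -exprM expnSr.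
- by rewrite -A1E AE exprMn -!exprM expnSr mulnC.
- by rewrite -B1E BE exprMn -!exprM expnSr mulnC.
Qed.

End Frobenius.

(** * The endomorphism ring and its degree form *)

Section TwistedFrobenius.
Variables (L : fieldType) (A B : L).

(** The q-power Frobenius followed by a scaling; the case q = 1 serves for automorphisms of the
    curve. *)
Definition twist (c e : L) (q : nat) (P : point L) : point L :=
  if P is Some (x, y) then Some (c * x ^+ q, e * y ^+ q) else None.

(** The Frobenius lands on the curve with coefficients [A ^+ q], [B ^+ q], and the scaling leads
    back. A single chart, c X^q : e Y^q : Z^q, serves all points. *)
Lemma twist_endo (c e : L) (q : nat) : (0 < q)%N ->
  (forall x y : L, (x + y) ^+ q = x ^+ q + y ^+ q) ->
  c != 0 -> e ^+ 2 = c ^+ 3 -> A = c ^+ 2 * A ^+ q -> B = c ^+ 3 * B ^+ q ->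
  is_endo A B (twist c e q).
Proof.
move=> q0 frob c0 ec hA hB; split=> //; split.
  case=> [[x y]|] //= /eqP h; apply/eqP.
  have {}h : (y ^+ q) ^+ 2 = (x ^+ q) ^+ 3 + A ^+ q * x ^+ q + B ^+ q.
    by rewrite exprAC h !frob [(A * x) ^+ q]exprMn [x ^+ 3 ^+ q]exprAC.
  transitivity (c ^+ 3 * (x ^+ q) ^+ 3 + (c ^+ 2 * A ^+ q) * (c * x ^+ q) + c ^+ 3 * B ^+ q).
    by rewrite [(e * _) ^+ 2]exprMn ec h; ring.
  by rewrite -hA -hB [(c * _) ^+ 3]exprMn.
have e0 : e != 0.
  by apply/eqP => e0; move/eqP: ec; rewrite e0 expr0n eq_sym expf_eq0 /= (negbTE c0).
move=> P hP; pose X (i : 'I_3) : mpoly.mpoly 3 L := 'X_i ^+ q.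
exists q, (fun i : 'I_3 => (nth 0 [:: c; e; 1] i) *: X i).
have hom (i : 'I_3) : is_homog q (nth 0 [:: c; e; 1] i *: X i).
  have : X i \is q.-homog.
    rewrite -[q]mul1n; apply: dhomogMn; by rewrite dhomogX /= mdeg1.
  by move/(dhomogZ (nth 0 [:: c; e; 1] i)); rewrite dhomogE.
have ev Q (i : 'I_3) : peval (nth 0 [:: c; e; 1] i *: X i) Q = nth 0 [:: c; e; 1] i * coords Q i ^+ q.
  by rewrite /peval mevalZ /X rmorphXn /= mevalXU.
split=> //; split.
  case: P {hP} => [[x y]|].
    by exists (Ordinal (isT : (2 < 3)%N)); rewrite ev /= mul1r expr1n oner_eq0.
  by exists (Ordinal (isT : (1 < 3)%N)); rewrite ev /= expr1n mulr1.
case=> [[x y]|] _ _.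
  exists 1; rewrite ?oner_eq0 // => i; rewrite ev mul1r.
  by case: i => [[|[|[|//]]] hi] /=; rewrite // mul1r expr1n.
exists e => // i; rewrite ev.
by case: i => [[|[|[|//]]] hi] /=; rewrite ?expr0n ?gtn_eqF ?mulr0 ?expr1n.
Qed.

End TwistedFrobenius.

Lemma xrep_opp (L : fieldType) (P : point L) f g : xrep (pt_opp P) f g <-> xrep P f g.
Proof. by case: P => [[x y]|]. Qed.

Lemma xrep_cross (L : fieldType) (P : point L) f g f' g' :
  xrep P f g -> xrep P f' g' -> f * g' = g * f'.
Proof.
case: P => [[x y]|] [h1 h2] [h1' h2']; first by rewrite h2 h2'; ring.
by rewrite h1 h1' mulr0 mul0r.
Qed.

Section EndomorphismRing.
Variables (p : nat) (L : closedFieldType) (A B : L).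
Hypotheses (hchar : p \in [pchar L]) (hp3 : (3 < p)%N).
Hypothesis ns : ec_nonsing A B.
Variables (a b c u v w : int) (psi : clf -> point L -> point L).
Hypothesis iso : End_iso_Clf A B a b c u v w psi.

Local Notation mul := (clf_mul a b c u v w).
Local Notation on P := (on_curve A B P).

Lemma two_neq0 : 2%:R != 0 :> L.
Proof. by apply: (nat_neq0 hchar); rewrite (leq_trans _ hp3). Qed.

Lemma psi_endo x : is_endo A B (psi x).
Proof. by case: iso. Qed.

Lemma psi_on x P : on P -> on (psi x P).
Proof. by case: (psi_endo x) => -[h _] _; apply: h. Qed.

Lemma psi_None x : psi x None = None.
Proof. by case: (psi_endo x). Qed.

Lemma psi_onto phi : is_endo A B phi -> exists x, forall P, on P -> psi x P = phi P.
Proof. by case: iso => _ [h _]; apply: h. Qed.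

Lemma psi_inj x y : (forall P, on (Some P) -> psi x (Some P) = psi y (Some P)) -> x = y.
Proof.
case: iso => _ [_ [h _]] e; apply: h => -[P|_]; first exact: e.
by rewrite !psi_None.
Qed.

Lemma psiD x y P : on P -> psi (clf_add x y) P = ec_add A (psi x P) (psi y P).
Proof. by case: iso => _ [_ [_ [h _]]]; apply: h. Qed.

Lemma psiM x y P : on P -> psi (mul x y) P = psi x (psi y P).
Proof. by case: iso => _ [_ [_ [_ [h _]]]]; apply: h. Qed.

Lemma psi1 P : on P -> psi (clf_int 1) P = P.
Proof. by case: iso => _ [_ [_ [_ [_ h]]]]; apply: h. Qed.

(** If doubling keeps the abscissa, the formula gives the ordinate [- y]; so y = -y, which is the
    case where the double is O. This yields [psi0] from 0 + 0 = 0. *)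
Lemma ec_add_idem (P : point L) : ec_add A P P = P -> P = None.
Proof.
case: P => [[x y]|] //=; rewrite eqxx /=; case: ifP => [//|/eqP yN [e1 e2]].
case: yN; move: e2; rewrite e1 subrr mulr0 sub0r => {1}<-.
by [].
Qed.

Lemma ec_add_eq_None (P Q : point L) : ec_add A P Q = None -> P = pt_opp Q.
Proof.
case: P Q => [[x1 y1]|] [[x2 y2]|] //=.
by case: ifP => // /andP[/eqP-> /eqP->].
Qed.

Lemma psi0 P : on P -> psi (clf_int 0) P = None.
Proof.
by move=> hP; apply: ec_add_idem; rewrite -psiD.
Qed.

Lemma psiN x P : on P -> psi (clf_opp x) P = pt_opp (psi x P).
Proof.
by move=> hP; apply: ec_add_eq_None; rewrite -psiD // clf_addN psi0.
Qed.

(** Comes from x (-1) = -x in the order; it supplies the oddness assumed in the study of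
    x-coordinates. *)
Lemma psi_odd x P : on P -> psi x (pt_opp P) = pt_opp (psi x P).
Proof.
move=> hP; rewrite -psiN // -(clf_mulN1 a b c u v w) psiM //.
by rewrite -[clf_int (-1)]/(clf_opp (clf_int 1)) psiN // psi1.
Qed.

Lemma psi_int (n : nat) P : on P -> psi (clf_int n%:Z) P = ec_mul A n P.
Proof.
move=> hP; elim: n => [|n IH]; first exact: psi0.
by rewrite -[n.+1%:Z]/(1 + n%:Z) -clf_intD psiD // psi1 // IH.
Qed.

Definition x_rep x (f g : {poly L}) := coprimep f g /\
  forall P, on (Some P) -> xrep (psi x (Some P)) f.[P.1] g.[P.1].

Definition has_deg x n := exists f g, x_rep x f g /\ has_height n (pair2 f g).

Lemma has_deg_exists x : exists n, has_deg x n.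
Proof.
have [f [g [cfg h _]]] := endo_xrep two_neq0 (psi_endo x) (@psi_odd x).
have [|n hn] := @has_height_exists L f g; last by exists n, f, g.
by have /orP[h0|h0] := coprime_horner 0 cfg; apply/orP; [left|right];
  apply: contra_neq h0 => ->; rewrite horner0.
Qed.

Lemma x_rep_uniq x f g f' g' : x_rep x f g -> x_rep x f' g' ->
  exists2 t, t != 0 & f = t *: f' /\ g = t *: g'.
Proof.
move=> [c1 h1] [c2 h2].
have e : f * g' = g * f'.
  apply: poly_eqP => x0; have [y hy] := exists_on_curve A B x0; rewrite !hornerM.
  exact: xrep_cross (h1 _ hy) (h2 _ hy).
have [x0|x0|i j|t t0 h] := @proportional L _ (pair2 f g) (pair2 f' g').
- by have /orP[h|h] := coprime_horner x0 c1; [exists true | exists false].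
- by have /orP[h|h] := coprime_horner x0 c2; [exists true | exists false].
- by case: i j => [] [] //=; rewrite e.
by exists t => //; split; [exact: (h true) | exact: (h false)].
Qed.

Lemma has_deg_uniq x m n : has_deg x m -> has_deg x n -> m = n.
Proof.
move=> [f [g [r hm]]] [f' [g' [r' hn]]].
have [t t0 [e1 e2]] := x_rep_uniq r r'.
by apply: has_height_uniq hm (has_heightZ t0 _ hn); case.
Qed.

Lemma has_deg0 : has_deg (clf_int 0) 0.
Proof.
exists 1, 0; split; last by split; [case; rewrite /= ?size_poly0 ?size_poly1 | exists true; rewrite coefC oner_eq0].
split; first exact: coprime1p.
by move=> P hP; rewrite psi0 //= horner0 -[1]/(1%:P) hornerC oner_eq0.
Qed.

Lemma has_deg1 : has_deg (clf_int 1) 1.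
Proof.
exists 'X, 1; split; last by split; [case; rewrite /= ?size_polyX ?size_poly1 | exists true; rewrite coefX oner_eq0].
split; first exact: coprimep1.
by move=> [x y] hP; rewrite psi1 //= hornerX -[1]/(1%:P) hornerC oner_eq0 mulr1.
Qed.

Lemma has_degN x n : has_deg x n -> has_deg (clf_opp x) n.
Proof.
move=> [f [g [[cfg h] hn]]]; exists f, g; split=> //; split=> // P hP.
by rewrite psiN //; apply/xrep_opp/h.
Qed.

Lemma has_degD y z n1 n2 n3 n4 : has_deg y n1 -> has_deg z n2 ->
  has_deg (clf_add y z) n3 -> has_deg (clf_add y (clf_opp z)) n4 ->
  (n3 + n4 = 2 * n1 + 2 * n2)%N.
Proof.
move=> [f1 [g1 [[c1 r1] h1]]] [f2 [g2 [[c2 r2] h2]]].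
move=> [f3 [g3 [[c3 r3] h3]]] [f4 [g4 [[c4 r4] h4]]].
apply: (height_parallelogram two_neq0 ns c1 c2 c3 c4 h1 h2 h3 h4) => x.
have [y0 hy] := exists_on_curve A B x.
have := r3 _ hy; have := r4 _ hy; rewrite !psiD // psiN // => e4 e3.
exact: (kummer_add two_neq0 (psi_on y hy) (psi_on z hy) (r1 _ hy) (r2 _ hy) e3 e4).
Qed.

Lemma height_const (f : {poly L}) n : coprimep f 0 -> has_height n (pair2 f 0) -> n = 0%N.
Proof.
rewrite coprimep0 => f1 h; have {f1} : size f == 1%N by rewrite (eqp_size f1) size_poly1.
move=> /size_poly1P [t t0 fE]; apply: has_height_uniq h _.
by split; [case; rewrite /= ?size_poly0 // fE size_polyC_leq1 | exists true; rewrite /= fE coefC].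
Qed.

Lemma has_degM y z n1 n2 n3 : has_deg y n1 -> has_deg z n2 ->
  has_deg (mul y z) n3 -> n3 = (n1 * n2)%N.
Proof.
move=> [f1 [g1 [[c1 r1] h1]]] [f2 [g2 [[c2 r2] h2]]] [f3 [g3 [[c3 r3] h3]]].
have [g20|g20] := eqVneq g2 0.
  (* Here [z] acts as O, hence so does [mul y z], and both have degree 0. *)
  have g30 : g3 = 0.
    apply: poly_eq0P => x; have [y0 hy] := exists_on_curve A B x.
    have := r3 _ hy; have := r2 _ hy; rewrite psiM // g20 horner0.
    case: (psi z _) => [[X Y] /= []|_]; first by rewrite eqxx.
    by rewrite psi_None => -[].
  rewrite g20 in c2 h2; rewrite g30 in c3 h3.
  by rewrite (height_const c2 h2) (height_const c3 h3) muln0.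
apply: (height_comp c1 c2 c3 h1 h2 h3 g20) => x gx.
have [y0 hy] := exists_on_curve A B x; split=> //.
have := r3 _ hy; have := r2 _ hy; have := psi_on z hy; rewrite psiM //=.
case: (psi z _) => [[X Y] hQ [_ fE]|_ [g0 _]]; last by rewrite g0 eqxx in gx.
by rewrite fE mulfK // => r; apply: xrep_cross r (r1 _ hQ).
Qed.

Lemma exists_degree : exists d : clf -> nat,
  [/\ forall x n, has_deg x n -> d x = n, d (clf_int 0) = 0%N, d (clf_int 1) = 1%N,
      forall y z, (d (clf_add y z) + d (clf_add y (clf_opp z)) = 2 * d y + 2 * d z)%N &
      (forall y, d (clf_opp y) = d y) /\ forall y z, d (mul y z) = (d y * d z)%N].
Proof.
have [d hd] := functional_choice has_deg has_deg_exists.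
have du x n : has_deg x n -> d x = n by apply: has_deg_uniq.
exists d; split=> //; [exact: du has_deg0 | exact: du has_deg1 | |split] => [y z|y|y z].
- exact: has_degD (hd y) (hd z) (hd _) (hd _).
- exact/du/has_degN.
- exact: has_degM (hd y) (hd z) (hd _).
Qed.

(** As no affine point goes to O, [g] has no root and is constant: the x-coordinate is a polynomial,
    and [polynomial_isogeny] applies from the curve to itself. *)
Lemma injective_x_rep x n : (forall P, on (Some P) -> psi x (Some P) <> None) ->
  has_deg x n -> (0 < n)%N ->
  exists k t, [/\ t != 0, n = (p ^ k)%N,
    (forall P, on (Some P) -> exists Y, psi x (Some P) = Some (t * P.1 ^+ (p ^ k), Y)),
    A = t ^+ 2 * A ^+ (p ^ k) & B = t ^+ 3 * B ^+ (p ^ k)].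
Proof.
move=> inj hn n0.
have [f [g [cfg r gen]]] := endo_xrep two_neq0 (psi_endo x) (@psi_odd x).
have [x0|t t0 gE] := @poly_size1P L g.
  have [y hy] := exists_on_curve A B x0; have := r _ hy; have := inj _ hy.
  by case: (psi x _) => [[X Y] _ []|].
have [N [h [N0 e]]] : exists N h : {poly L}, N != 0 /\
    N ^+ 2 * (f ^+ 3 + A *: (f * g ^+ 2) + B *: g ^+ 3) = h ^+ 2 * cubic A B * g ^+ 3.
  by apply: gen; rewrite gE polyC_eq0.
pose R := t^-1 *: f.
have fE : f = t%:P * R by rewrite mul_polyC scalerA divff // scale1r.
have [|s _ RE] := @sqr_dvd_separable L (cubic A B) N (R ^+ 3 + A *: R + B%:P) h
    (cubic_separable ns) N0.
  apply: (mulfI (_ : t%:P ^+ 3 != 0)); first by rewrite expf_neq0 // polyC_eq0.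
  transitivity (N ^+ 2 * (f ^+ 3 + A *: (f * g ^+ 2) + B *: g ^+ 3)).
    by rewrite gE fE -!mul_polyC; ring.
  by rewrite e gE; ring.
have szR : size R = size f by rewrite size_scale // invr_eq0.
(* As n > 0, the constant [g] has zero coefficient in degree n, so that of [f] is nonzero. *)
have nE : size f = n.+1.
  have [|m hm] := @has_height_exists L f g; first by rewrite gE polyC_eq0 t0 orbT.
  have mn : m = n by apply: has_deg_uniq hn; exists f, g.
  move: hm; rewrite mn gE => -[/(_ true) /= sf [[] /= top]]; last first.
    by move: top; rewrite coefC gtn_eqF // eqxx.
  apply/eqP; rewrite eqn_leq sf ltnNge /=; apply: contra top => le.
  by rewrite nth_default.
have [|k [s0 s00 [RE' AE BE]]] := polynomial_isogeny hchar hp3 ns ns _ RE.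
  by rewrite szR nE.
exists k, s0; split=> //.
  by apply: succn_inj; rewrite -nE -szR RE' size_scale // size_polyXn.
move=> P hP; have := r P hP; case: (psi x _) => [[X Y]|]; last first.
  by rewrite gE hornerC => -[/eqP]; rewrite (negbTE t0).
rewrite fE gE hornerM hornerC => -[_]; rewrite mulrC => /(mulIf t0) <-.
by exists Y; rewrite RE' hornerZ hornerXn.
Qed.

(** At each point [y + z] or [y - z] is O. The sign is uniform because the product [g3 * g4] of
    their denominators vanishes identically, so one factor is 0. *)
Lemma eq_x_coordinate y z :
  (forall P, on (Some P) -> exists X Y Y',
     psi y (Some P) = Some (X, Y) /\ psi z (Some P) = Some (X, Y')) ->
  y = z \/ y = clf_opp z.
Proof.
move=> h.
have zero x f : x_rep x f 0 -> x = clf_int 0.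
  move=> [_ r]; apply: psi_inj => P hP; rewrite psi0 //.
  by have := r P hP; rewrite horner0; case: (psi x _) => [[X Y] []|//]; rewrite eqxx.
have [n3 [f3 [g3 [r3 _]]]] := has_deg_exists (clf_add y z).
have [n4 [f4 [g4 [r4 _]]]] := has_deg_exists (clf_add y (clf_opp z)).
have /eqP : g3 * g4 = 0.
  apply: poly_eq0P => x; have [y0 hy] := exists_on_curve A B x.
  have := r3.2 _ hy; have := r4.2 _ hy; rewrite !psiD // psiN //.
  have [X [Y [Y' [ey ez]]]] := h _ hy.
  have := psi_on y hy; have := psi_on z hy; rewrite ey ez /= hornerM.
  move=> /eqP e1 /eqP e2; rewrite eqxx opprK /=.
  have : (Y == Y') || (Y == - Y') by rewrite -eqf_sqr e1 e2.
  by case/orP=> -> /=; [case=> -> _ _; rewrite mulr0 | move=> _ [-> _]; rewrite mul0r].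
rewrite mulf_eq0 => /orP[] /eqP g0; [right | left].
  by apply: clf_addI; rewrite clf_oppK; rewrite g0 in r3; apply: zero r3.
by apply: clf_addI; rewrite g0 in r4; apply: zero r4.
Qed.

Lemma psi_opp_None x P : on P -> psi (clf_opp x) P = None -> psi x P = None.
Proof. by move=> hP; rewrite psiN //; case: (psi x P) => [[X Y]|]. Qed.

(** * Supersingularity and square roots of -p *)

Section Supersingular.
Hypothesis p_pr : prime p.
Hypotheses (hA : A ^+ (p ^ 2) = A) (hB : B ^+ (p ^ 2) = B).
Hypothesis ss : supersingular p A B.

Lemma psi_p_None P : on P -> psi (clf_int p%:Z) P = None -> P = None.
Proof. by move=> hP; rewrite psi_int //; apply: ss. Qed.

(** A point killed by [x] is killed by p, hence is O. From d(x)^2 = d(-p) = p^2 the degree is p,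
    which fixes the power in [injective_x_rep]. *)
Lemma isogenous_of_sqrtNp x : mul x x = clf_int (- p%:Z) ->
  exists2 t, t != 0 & A = t ^+ 2 * A ^+ p /\ B = t ^+ 3 * B ^+ p.
Proof.
move=> hx; have [d [du d0 d1 dD [dN dM]]] := exists_degree.
have dx : d x = p.
  have : (d x * d x = p * p)%N.
    apply/eqP; rewrite -eqz_nat -dM hx; apply/eqP.
    by rewrite (degree_int d0 d1 dD) sqrrN.
  by move/eqP; rewrite !mulnn eqn_exp2r // => /eqP.
have [n hn] := has_deg_exists x; have nE := du _ _ hn; rewrite dx in nE.
have [P hP e||k [t [t0 pk _ AE BE]]] := injective_x_rep _ hn.
- suff : Some P = None :> point L by [].
  apply: psi_p_None => //; apply: psi_opp_None => //.
  by rewrite -[clf_opp _]/(clf_int (- p%:Z)) -hx psiM // e psi_None.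
- by rewrite -nE prime_gt0.
by exists t => //; rewrite -pk -nE in AE BE.
Qed.

Lemma sqrtNp_of_isogenous t : t != 0 -> A = t ^+ 4 * A ^+ p -> B = t ^+ 6 * B ^+ p ->
  exists x, clf_tr u v w x = 0 /\ clf_nm a b c u v w x = p%:Z.
Proof.
move=> t0 AE BE; have [d [du d0 d1 dD [dN dM]]] := exists_degree.
have p0 := prime_gt0 p_pr.
pose la := t ^+ 2.
have la0 : la != 0 by rewrite expf_neq0.
have AE2 : A = la ^+ 2 * A ^+ p by rewrite -exprM.
have BE2 : B = la ^+ 3 * B ^+ p by rewrite -exprM.
have [x hx] : exists x, forall P, on P -> psi x P = twist la (t ^+ 3) p P.
  apply: psi_onto; apply: twist_endo => //; last by rewrite -!exprM.
  by move=> *; apply: frobeniusD.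
have [n hn] := has_deg_exists (clf_int p%:Z).
have nE : n = (p ^ 2)%N.
  have := degree_int d0 d1 dD p%:Z; rewrite (du _ _ hn) => h.
  by apply/eqP; rewrite -eqz_nat h.
(* Supersingularity makes the kernel of [p] trivial, so its x-coordinate is s x^(p^2). *)
have [P hP e||k [s [s0 pk sE AsE BsE]]] := injective_x_rep _ hn.
- by have := psi_p_None hP e.
- by rewrite nE expn_gt0 p0.
rewrite -pk nE hA in AsE; rewrite -pk nE hB in BsE; rewrite -pk nE in sE.
(* The x-coordinates of [mul x x] and [p] are [la * la ^+ p] and [s] times x^(p^2). Scaling by the
   ratio [ze] gives an automorphism, since [A] and [B] are fixed by the p^2-power. *)
pose ze := la * la ^+ p / s.
have ze0 : ze != 0 by rewrite !mulf_neq0 ?invr_eq0 ?expf_neq0.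
have [eta etaE] := closed_field_root ze (isT : (0 < 2)%N).
have Aze : A = ze ^+ 2 * A.
  have e1 : A = (la * la ^+ p) ^+ 2 * A.
    have Xp : A ^+ p = (la ^+ p) ^+ 2 * A.
      by rewrite {1}AE2 [(_ * _) ^+ p]exprMn -[A ^+ p ^+ p]exprM mulnn hA exprAC.
    by rewrite {1}AE2 Xp; ring.
  by apply: (mulfI (expf_neq0 2 s0)); rewrite -AsE {1}e1 /ze; field.
have Bze : B = ze ^+ 3 * B.
  have e1 : B = (la * la ^+ p) ^+ 3 * B.
    have Xp : B ^+ p = (la ^+ p) ^+ 3 * B.
      by rewrite {1}BE2 [(_ * _) ^+ p]exprMn -[B ^+ p ^+ p]exprM mulnn hB exprAC.
    by rewrite {1}BE2 Xp; ring.
  by apply: (mulfI (expf_neq0 3 s0)); rewrite -BsE {1}e1 /ze; field.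
have [ep hep] : exists x, forall P, on P -> psi x P = twist ze (eta ^+ 3) 1 P.
  apply: psi_onto; apply: twist_endo => //.
  by rewrite -etaE -!exprM.
have [ep' hep'] : exists x, forall P, on P -> psi x P = twist ze^-1 (eta ^- 3) 1 P.
  apply: psi_onto; apply: twist_endo; rewrite ?invr_eq0 //.
  - by rewrite -etaE -!exprVn -!exprM.
  - by apply: (mulfI (expf_neq0 2 ze0)); rewrite -Aze; field.
  - by apply: (mulfI (expf_neq0 3 ze0)); rewrite -Bze; field.
have unit : clf_nm a b c u v w ep * clf_nm a b c u v w ep' = 1.
  have e : mul ep ep' = clf_int 1.
    have eta0 : eta != 0 by move: ze0; rewrite -etaE expf_eq0.
    apply: psi_inj => -[X Y] hP; rewrite psi1 // psiM // hep ?psi_on // hep' //= !expr1.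
    by rewrite !mulrA !divff ?expf_neq0 // !mul1r.
  by rewrite -clf_nmM e clf_nm_int.
have [ep1 nm1 xx] : exists2 ep1, clf_nm a b c u v w ep1 = clf_nm a b c u v w ep &
    mul x x = mul ep1 (clf_int p%:Z).
  have [P hP|->|->] := @eq_x_coordinate (mul x x) (mul ep (clf_int p%:Z)).
  - have [Y eY] := sE P hP; rewrite !psiM // eY hep; last by rewrite -eY psi_on.
    rewrite hx ?psi_on // hx //; case: P hP eY => X0 Y0 hP eY /=.
    do 3 eexists; split; first by [].
    congr (Some (_, _)); rewrite expr1 [(la * _) ^+ p]exprMn -[X0 ^+ p ^+ p]exprM mulnn /ze.
    by field.
  - by exists ep.
  - by exists (clf_opp ep); case: (ep) => [[[? ?] ?] ?] /=; [ring | congr (_, _, _, _); ring].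
set nx := clf_nm a b c u v w x.
have nm2 : nx ^+ 2 = clf_nm a b c u v w ep * p%:Z ^+ 2.
  by have := congr1 (clf_nm a b c u v w) xx; rewrite !clf_nmM clf_nm_int nm1 -expr2.
(* The norm of a unit divides 1, and -1 is excluded because nx^2 >= 0. *)
have ep1E : clf_nm a b c u v w ep = 1.
  have : (clf_nm a b c u v w ep %| 1)%Z.
    by apply/dvdzP; exists (clf_nm a b c u v w ep'); rewrite mulrC.
  rewrite dvdz1 => e1; have : (0 : int) <= nx ^+ 2 by apply: sqr_ge0.
  rewrite nm2 pmulr_lge0; last by rewrite exprn_gt0.
  by move: e1; clear; lia.
rewrite ep1E mul1r in nm2.
have [sg [sg2 nE']] : exists sg : int, sg ^+ 2 = 1 /\ nx = sg * p%:Z.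
  move/eqP: nm2; rewrite eqf_sqr => /orP[] /eqP ->.
    by exists 1; rewrite mul1r expr1n.
  by exists (-1); rewrite mulN1r sqrrN expr1n.
(* By Cayley-Hamilton, tr(x) x = x^2 + nx = (ep1 + sg) p. In norms, tr(x)^2 sg p is a multiple of
   p^2, so p divides tr(x)^2. *)
have dvd_tr : (p%:Z %| clf_tr u v w x)%Z.
  have e : mul (clf_int (clf_tr u v w x)) x = mul (clf_add ep1 (clf_int sg)) (clf_int p%:Z).
    have : clf_add (mul x x) (clf_int nx) = clf_add (mul ep1 (clf_int p%:Z)) (clf_int nx).
      by rewrite xx.
    rewrite clf_sqr -clf_addA clf_intD addNr clf_addC clf_add0 => ->.
    rewrite nE'; case: (ep1) => [[[e0 e1] e2] e3] /=; congr (_, _, _, _); ring.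
  have := congr1 (clf_nm a b c u v w) e; rewrite !clf_nmM !clf_nm_int -/nx nE'.
  set N := clf_nm _ _ _ _ _ _ _ => eN.
  have pz : (p%:Z : int) != 0 by move: p0; clear; lia.
  have : (p%:Z %| clf_tr u v w x ^+ 2)%Z.
    apply/dvdzP; exists (sg * N); apply: (mulIf pz).
    transitivity (sg * (clf_tr u v w x ^+ 2 * (sg * p%:Z))); last by rewrite eN; ring.
    transitivity (sg ^+ 2 * (clf_tr u v w x ^+ 2 * p%:Z)); first by rewrite sg2 mul1r.
    by ring.
  by rewrite !dvdzE abszX Euclid_dvdX // => /andP[].
exists x.
exact: (@trace_zero_of_degree a b c u v w d d0 d1 dD dN dM p x p_pr hp3 nm2 dvd_tr).
Qed.

End Supersingular.
End EndomorphismRing.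

(** * Frobenius and the j-invariant *)

Section JInvariant.
Variables (p : nat) (L : closedFieldType) (A B : L).
Hypotheses (hchar : p \in [pchar L]) (hp3 : (3 < p)%N).
Hypothesis ns : ec_nonsing A B.

(** The images of the integers 0, ..., p - 1 are p distinct roots of X^p - X, which has no further
    root. *)
Lemma prime_field_fixed (x : L) : (exists n : nat, x = n%:R) <-> x ^+ p = x.
Proof.
have p_pr : prime p by case/andP: hchar.
split=> [[n ->]|xp]; first exact: frobenius_nat.
pose q : {poly L} := 'X^p - 'X.
have szq : size q = p.+1.
  by rewrite size_polyDl ?size_polyXn // size_polyN size_polyX ltnS prime_gt1.
have q0 : q != 0 by rewrite -size_poly_gt0 szq.
pose s : seq L := [seq (i%:R : L) | i <- iota 0 p].
have us : uniq s.
  rewrite map_inj_in_uniq ?iota_uniq // => i j; rewrite !mem_iota !add0n /=.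
  wlog le : i j / (i <= j)%N => [W|] hi hj e.
    by have [|/ltnW] := leqP i j => le; [apply: W | apply/esym/W].
  apply/eqP; rewrite eqn_leq le leqNgt; apply/negP => lt.
  have /eqP : (j - i)%:R = 0 :> L by rewrite natrB // e subrr.
  by apply/negP/(nat_neq0 hchar); rewrite subn_gt0 lt (leq_ltn_trans (leq_subr _ _)).
have [/mapP[i _ ->]|xs] := boolP (x \in s); first by exists i.
have := @max_poly_roots L q (x :: s) q0; rewrite /= xs us szq size_map size_iota ltnn.
move=> h; suff : false by []; apply: h => //.
apply/andP; split; first by rewrite rootE !hornerE xp subrr.
apply/allP => y /mapP[i _ ->].
by rewrite rootE !hornerE frobenius_nat // subrr.
Qed.

Lemma disc_frobenius : (4%:R * A ^+ 3 + 27%:R * B ^+ 2) ^+ p =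
  4%:R * (A ^+ p) ^+ 3 + 27%:R * (B ^+ p) ^+ 2.
Proof.
by rewrite frobeniusD // ![(_%:R * _) ^+ p]exprMn !frobenius_nat // ![_ ^+ p ^+ _](exprAC _ p).
Qed.

Lemma j_inv_frobenius : j_inv A B ^+ p = j_inv (A ^+ p) (B ^+ p).
Proof.
rewrite /j_inv -disc_frobenius exprMn exprVn [(_%:R * (_ * _)) ^+ p]exprMn.
by rewrite [(_%:R * _) ^+ p]exprMn !frobenius_nat // (exprAC A).
Qed.

(** Equal j-invariants give A'^3 B^2 = A^3 B'^2 for the conjugate coefficients A', B', and the roots
    needed for [t] exist in the closed field. *)
Lemma twist_of_j_inv : j_inv A B ^+ p = j_inv A B ->
  exists2 t, t != 0 & A = t ^+ 4 * A ^+ p /\ B = t ^+ 6 * B ^+ p.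
Proof.
have two0 : 2%:R != 0 :> L by apply: (nat_neq0 hchar); rewrite (leq_trans _ hp3).
have three0 : 3%:R != 0 :> L by apply: (nat_neq0 hchar).
have four0 : 4%:R != 0 :> L by rewrite (natrM _ 2 2) mulf_neq0.
have p0 : (0 < p)%N by rewrite (leq_trans _ hp3).
rewrite j_inv_frobenius /j_inv => e.
have D'0 : 4%:R * (A ^+ p) ^+ 3 + 27%:R * (B ^+ p) ^+ 2 != 0.
  by rewrite -disc_frobenius expf_neq0.
have h : (A ^+ p) ^+ 3 * B ^+ 2 = A ^+ 3 * (B ^+ p) ^+ 2.
  (* The constant factor left after cross-multiplying the two j-invariants. *)
  have c0 : 1728%:R * 4%:R * 27%:R != 0 :> L.
    have -> : 1728%:R * 4%:R * 27%:R = 2%:R ^+ 8 * 3%:R ^+ 6 :> L by ring.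
    by rewrite mulf_neq0 ?expf_neq0.
  apply: (mulfI c0); apply/eqP; rewrite -subr_eq0; apply/eqP.
  move: e => /eqP; rewrite eqr_div // -subr_eq0 => /eqP e; rewrite -[RHS]e; ring.
have root n (x : L) : (0 < n)%N -> x != 0 -> exists2 t, t != 0 & x = t ^+ n * x ^+ p.
  move=> n0 x0; have [t tE] := closed_field_root (x / x ^+ p) n0.
  have xp0 : x ^+ p != 0 by rewrite expf_neq0.
  exists t; last by rewrite tE divfK.
  apply/eqP => t0; move/esym/eqP: tE; rewrite t0 expr0n gtn_eqF //.
  by rewrite mulf_eq0 invr_eq0 (negbTE x0) (negbTE xp0).
(* If one coefficient is 0, only the other constrains [t]: a sixth root is taken for A = 0 and a
   fourth root for B = 0. *)
have [A0|A0] := eqVneq A 0.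
  have B0 : B != 0.
    by apply: contra_eq_neq ns => /= B0; rewrite /ec_nonsing A0 B0 !expr0n !mulr0 addr0 eqxx.
  have [t t0 tE] := root 6%N B isT B0; exists t => //; split=> //.
  by rewrite A0 expr0n gtn_eqF // mulr0.
have [B0|B0] := eqVneq B 0.
  have [t t0 tE] := root 4%N A isT A0; exists t => //; split=> //.
  by rewrite B0 expr0n gtn_eqF // mulr0.
have Ap0 : A ^+ p != 0 by rewrite expf_neq0.
have Bp0 : B ^+ p != 0 by rewrite expf_neq0.
(* The two equations force t^2 = t^6 / t^4 to be this quotient, and [h] makes it sufficient. *)
pose mu := (B / B ^+ p) / (A / A ^+ p).
have [t tE] := closed_field_root mu (isT : (0 < 2)%N).
exists t; first by apply/eqP => t0; move/esym/eqP: tE; rewrite t0 expr0n !mulf_eq0 !invr_eq0 mulf_eq0 invr_eq0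
  (negbTE A0) (negbTE B0) (negbTE Ap0) (negbTE Bp0).
have -> : t ^+ 4 = mu ^+ 2 by rewrite -tE -exprM.
have -> : t ^+ 6 = mu ^+ 3 by rewrite -tE -exprM.
move: (A ^+ p) (B ^+ p) @mu h Ap0 Bp0 {tE D'0 e} => A' B' mu h A'0 B'0; split.
  apply: (mulfI (mulf_neq0 (expf_neq0 2 A0) (expf_neq0 2 B'0))).
  transitivity (A ^+ 3 * B' ^+ 2); first by ring.
  by rewrite -h /mu; field; rewrite A0 A'0 B'0.
apply: (mulfI (mulf_neq0 (expf_neq0 3 A0) (expf_neq0 2 B'0))).
transitivity (A ^+ 3 * B' ^+ 2 * B); first by ring.
by rewrite -{1}h /mu; field; rewrite A0 A'0 B'0.
Qed.

Lemma j_inv_of_twist t : t != 0 -> A = t ^+ 2 * A ^+ p -> B = t ^+ 3 * B ^+ p ->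
  j_inv A B ^+ p = j_inv A B.
Proof.
move=> t0 AE BE; rewrite j_inv_frobenius.
have D'0 : 4%:R * (A ^+ p) ^+ 3 + 27%:R * (B ^+ p) ^+ 2 != 0.
  by rewrite -disc_frobenius expf_neq0.
move: (A ^+ p) (B ^+ p) AE BE D'0 => A' B' AE BE D'0; rewrite AE BE /j_inv.
have -> : 4%:R * (t ^+ 2 * A') ^+ 3 + 27%:R * (t ^+ 3 * B') ^+ 2
  = t ^+ 6 * (4%:R * A' ^+ 3 + 27%:R * B' ^+ 2) by ring.
by field; rewrite D'0 t0.
Qed.

End JInvariant.

Theorem mainTheorem4
  (p : nat) (hp : prime p) (hp3 : (3 < p)%N)
  (L : closedFieldType) (hchar : p \in [pchar L])
  (A B : L) (hA : A ^+ (p ^ 2) = A) (hB : B ^+ (p ^ 2) = B)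
  (hns : ec_nonsing A B) (hss : supersingular p A B)
  (a b c u v w : int) (hdisc : form_disc a b c u v w = p%:Z)
  (hiso : exists psi, End_iso_Clf A B a b c u v w psi) :
  (exists n : nat, j_inv A B = n%:R) <-> properly_represents a b c u v w 2.
Proof.
have [psi iso] := hiso; rewrite (prime_field_fixed hchar); split.
  case/(twist_of_j_inv hchar hp3 hns) => t t0 [AE BE].
  have [x [trx nmx]] := sqrtNp_of_isogenous hchar hp3 hns iso hp hA hB hss t0 AE BE.
  exact: (form_val_of_clf_nm hp hdisc trx nmx).
move=> [x [y [z [_ F2]]]].
have [r rE] := clf_sqrN_of_form_val F2; rewrite hdisc in rE.
have [t t0 [AE BE]] := isogenous_of_sqrtNp hchar hp3 hns iso hp hss rE.
exact: (j_inv_of_twist hchar hns t0 AE BE).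
Qed.
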